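(* Let $T>0$, $\mathbb{T}=[0,T]$, $H\in(0,1)$, and let $L\ge 1$ be an integer. Let $B_H(t)=\int_0^t k_H(t,\tau)\,dB(\tau)$, $t\in\mathbb T$, be the fractional Brownian motion with Hurst index $H$ driven by a standard Brownian motion $B$. Let $\hat P(i,\cdot)$ be the normalized Legendre polynomials on $[0,T]$, $\mathcal V_j=\int_{\mathbb T}\hat P(j,t)\,dB(t)$, and $$\tilde B_H(t)=\sum_{i=0}^{L-1}\sum_{j=0}^{L-1}K_{ij}^H\,\mathcal V_j\,\hat P(i,t),\qquad \tilde B_H^*(t)=\sum_{i=0}^{L-1}\sum_{j=0}^{L-1}\tilde K_{ij}^H\,\mathcal V_j\,\hat P(i,t),\qquad t\in\mathbb T,$$ where $\bar K^H=(K_{ij}^H)_{0\le i,j\le L-1}$ and $\tilde K^H=(\tilde K^H_{ij})_{0\le i,j\le L-1}$ are the $L\times L$ matrices defined in the context. Then the mean square approximation errors $$\varepsilon=\mathrm E\int_{\mathbb T}\bigl(B_H(t)-\tilde B_H(t)\bigr)^2dt,\qquad \varepsilon^*=\mathrm E\int_{\mathbb T}\bigl(B_H(t)-\tilde B_H^*(t)\bigr)^2dt$$ satisfy $$\varepsilon=\|k_H\|^2_{L_2(\mathbb T^2)}-\|\bar K^H\|^2,\qquad \varepsilon^*=\|k_H\|^2_{L_2(\mathbb T^2)}-\|\bar K^H\|^2+\|\bar K^H-\tilde K^H\|^2,$$ where $$\|k_H\|^2_{L_2(\mathbb T^2)}=\frac{T^{2H+1}}{2H+1}$$ and $\|\cdot\|$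 is the Euclidean (Frobenius) norm of a matrix.
   Context: Fractional Brownian motion with Hurst index $H$ is the centered Gaussian process with covariance function $R_H(t,\tau)=\frac12\bigl(t^{2H}+\tau^{2H}-|t-\tau|^{2H}\bigr)$, $t,\tau\ge0$. It is represented as $B_H(t)=\int_0^t k_H(t,\tau)\,dB(\tau)$ (Itô integral with respect to a standard Brownian motion $B$; a known representation the paper takes from the literature), with the kernel $$k_H(t,\tau)=\frac{a_H}{\Gamma(H+1/2)}\,(t-\tau)^{H-1/2}\;{}_2F_1\Bigl(\tfrac12-H,\,H-\tfrac12,\,H+\tfrac12,\,1-\tfrac{t}{\tau}\Bigr)\quad(0<\tau<t),\qquad k_H(t,\tau)=0\quad(t\le\tau),$$ $$a_H=\sqrt{\frac{2H\,\Gamma(H+1/2)\,\Gamma(3/2-H)}{\Gamma(2-2H)}},$$ where $\Gamma$ is the Gamma function and ${}_2F_1$ the Gauss hypergeometric function (analytically continued to real arguments less than $1$). For $H=1/2$, $k_{1/2}(t,\tau)=1$ if $\tau<t$ and $0$ otherwise. One has $\int_0^T k_H(t,\theta)k_H(\tau,\theta)\,d\theta=R_H(t,\tau)$ for $t,\tau\in[0,T]$. Normalized Legendre polynomials on $[0,T]$ (an orthonormal basis of $L_2([0,T])$): $$\hat P(i,t)=\sqrt{\frac{2i+1}{T}}\sum_{k=0}^{i}l_{ik}\frac{t^k}{T^k},\qquad l_{ik}=(-1)^{i-k}\binom{i+k}{i}\binom{i}{i-k},\qquad i=0,1,2,\dots$$ The random variables $\mathcal V_j=\int_0^T\hat P(j,t)\,dB(t)$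 are independent standard normal. Matrix $\bar K^H$: the $L\times L$ matrix with elements $$K_{ij}^H=\int_{[0,T]^2}\hat P(i,t)\,\hat P(j,\tau)\,k_H(t,\tau)\,dt\,d\tau,\qquad 0\le i,j\le L-1.$$ Matrix $\tilde K^H$: for $\alpha>-1/2$ and $\beta>0$ let $\bar A^\alpha$ and $\bar P^{-\beta}$ be the $L\times L$ matrices with elements ($0\le i,j\le L-1$) $$A_{ij}^\alpha=\int_0^T\hat P(i,t)\,t^\alpha\,\hat P(j,t)\,dt,\qquad P_{ij}^{-\beta}=\int_0^T\hat P(i,t)\,\biggl[\frac1{\Gamma(\beta)}\int_0^t\frac{\hat P(j,\tau)\,d\tau}{(t-\tau)^{1-\beta}}\biggr]dt,$$ i.e. the truncated matrix representations of multiplication by $t^\alpha$ and of the left-sided Riemann–Liouville fractional integral of order $\beta$. Then (product of $L\times L$ matrices) $$\tilde K^H=\begin{cases}a_H\,\bar P^{-2H}\,\bar A^{1/2-H}\,\bar P^{-(1/2-H)}\,\bar A^{H-1/2},&H<1/2,\\ \bar P^{-1}\;(=\bar K^{1/2}),&H=1/2,\\ a_H\,\bar P^{-1}\,\bar A^{H-1/2}\,\bar P^{-(H-1/2)}\,\bar A^{1/2-H},&H>1/2.\end{cases}$$ *)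

(* Defs.v *)
From HB Require Import structures.
From mathcomp Require Import all_boot all_order all_algebra.
From mathcomp Require Import all_classical all_reals all_analysis.

Set Implicit Arguments.
Unset Strict Implicit.
Unset Printing Implicit Defensive.

Import Order.TTheory GRing.Theory Num.Theory.
Import numFieldNormedType.Exports.

Local Open Scope classical_set_scope.
Local Open Scope ring_scope.

Section SpecialFunctions.
Context {R : realType}.
Local Notation mu := (@lebesgue_measure R).

(* Euler's integral; meaningful for 0 < x. *)
Definition Gamma (x : R) : R :=
  \int[mu]_(u in `]0, +oo[) (u `^ (x - 1) * expR (- u)).

Definition rising_factorial (a : R) (n : nat) : R :=
  \prod_(k < n) (a + k%:R).

Definition hyp2F1_coeff (a b c : R) (n : nat) : R :=
  rising_factorial a n * rising_factorial b n
  / (rising_factorial c n * n`!%:R).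

Definition real_analytic_on (D : set R) (f : R -> R) : Prop :=
  forall x, D x ->
    exists a : nat -> R, \forall y \near x, pseries a (y - x) @ \oo --> f y.

Definition is_hyp2F1 (a b c : R) (F : R -> R) : Prop :=
  real_analytic_on `]-oo, 1[ F /\
  forall z, `|z| < 1 -> pseries (hyp2F1_coeff a b c) z @ \oo --> F z.

(* By the identity theorem [is_hyp2F1 a b c] determines F on ]-oo, 1[, so the
   choice made by [get] only affects the unused values on [1, +oo[.  The
   continuation exists classically when c is not a nonpositive integer. *)
Definition hyp2F1 (a b c : R) : R -> R := get [set F | is_hyp2F1 a b c F].

End SpecialFunctions.

Section Kernel.
Context {R : realType}.
Local Notation mu := (@lebesgue_measure R).

Definition fbm_const (H : R) : R :=
  Num.sqrt (2 * H * Gamma (H + 2^-1) * Gamma (3 / 2 - H) / Gamma (2 - 2 * H)).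

(* The line tau = 0, where 1 - t / tau is undefined, is given the value 0; it
   is negligible.  For H = 1/2 the formula reduces to 1 on 0 < tau < t. *)
Definition fbm_kernel (H t tau : R) : R :=
  if 0 < tau < t then
    fbm_const H / Gamma (H + 2^-1) * (t - tau) `^ (H - 2^-1)
    * hyp2F1 (2^-1 - H) (H - 2^-1) (H + 2^-1) (1 - t / tau)
  else 0.

Definition fbm_cov (H t tau : R) : R :=
  2^-1 * (t `^ (2 * H) + tau `^ (2 * H) - `|t - tau| `^ (2 * H)).

Definition fbm_kernel_normsq (H T : R) : \bar R :=
  (\int[mu \x mu]_(z in `[0%R, T] `*` `[0%R, T])
     ((fbm_kernel H z.1 z.2) ^+ 2)%:E)%E.

End Kernel.

Section Matrices.
Context {R : realType}.
Local Notation mu := (@lebesgue_measure R).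

Definition legendre_coeff (i k : nat) : R :=
  (-1) ^+ (i - k) * 'C(i + k, i)%:R * 'C(i, i - k)%:R.

Definition legendre (T : R) (i : nat) (t : R) : R :=
  Num.sqrt ((2 * i + 1)%:R / T)
  * \sum_(k < i.+1) legendre_coeff i k * (t ^+ k / T ^+ k).

Definition kernel_mx (H T : R) (L : nat) : 'M[R]_L :=
  \matrix_(i, j)
    \int[(mu \x mu)%E]_(z in `[0, T] `*` `[0, T])
      (legendre T i z.1 * legendre T j z.2 * fbm_kernel H z.1 z.2).

Definition power_mx (T : R) (L : nat) (alpha : R) : 'M[R]_L :=
  \matrix_(i, j)
    \int[mu]_(t in `[0, T]) (legendre T i t * t `^ alpha * legendre T j t).

(* Left-sided Riemann-Liouville integral of order [beta] > 0. *)
Definition fractional_integral (beta : R) (f : R -> R) (t : R) : R :=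
  (Gamma beta)^-1 * \int[mu]_(tau in `[0, t]) (f tau / (t - tau) `^ (1 - beta)).

(* [fracint_mx T L beta] is the matrix of exponent - beta. *)
Definition fracint_mx (T : R) (L : nat) (beta : R) : 'M[R]_L :=
  \matrix_(i, j)
    \int[mu]_(t in `[0, T])
      (legendre T i t * fractional_integral beta (legendre T j) t).

Definition approx_kernel_mx (H T : R) (L : nat) : 'M[R]_L :=
  if H < 2^-1 then
    fbm_const H *: (fracint_mx T L (2 * H) *m power_mx T L (2^-1 - H)
                    *m fracint_mx T L (2^-1 - H) *m power_mx T L (H - 2^-1))
  else if H == 2^-1 then fracint_mx T L 1
  else
    fbm_const H *: (fracint_mx T L 1 *m power_mx T L (H - 2^-1)
                    *m fracint_mx T L (H - 2^-1) *m power_mx T L (2^-1 - H)).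

Definition frobenius_norm (m n : nat) (M : 'M[R]_(m, n)) : R :=
  Num.sqrt (\sum_i \sum_j M i j ^+ 2).

End Matrices.

Section Processes.
Context {R : realType} {d : measure_display} {Omega : measurableType d}
  (P : probability Omega R).
Local Notation mu := (@lebesgue_measure R).

(* [s] is the standard deviation.  The degenerate case is separate because
   [normal_prob m 0] is not the Dirac mass at m. *)
Definition normal_law (m s : R) (X : Omega -> R) : Prop :=
  forall A : set R, measurable A ->
    P (X @^-1` A) = if s == 0 then (\d_m A)%E else normal_prob m s A.

(* As the sets A i may be the full line, the product rule for the whole family
   contains the one for every subfamily. *)
Definition mutually_independent (n : nat) (X : 'I_n -> Omega -> R) : Prop :=
  forall A : 'I_n -> set R, (forall i, measurable (A i)) ->
    P (\bigcap_(i in [set: 'I_n]) (X i @^-1` A i))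
    = (\prod_(i < n) P (X i @^-1` A i))%E.

Definition brownian_motion (T : R) (B : R -> {RV P >-> R}) : Prop :=
  [/\ {ae P, forall w, B 0 w = 0},
      forall (n : nat) (t : nat -> R),
        (forall k, 0 <= t k <= T) -> (forall k, t k <= t k.+1) ->
        @mutually_independent n (fun k w => B (t k.+1) w - B (t k) w),
      forall s t : R, 0 <= s -> s < t -> t <= T ->
        normal_law 0 (Num.sqrt (t - s)) (fun w => B t w - B s w)
    & {ae P, forall w, {within `[0, T], continuous (fun t => B t w)}}].

(* Every finite linear combination has a (possibly degenerate) normal law. *)
Definition gaussian_process (T : R) (X : R -> {RV P >-> R}) : Prop :=
  forall (n : nat) (t c : 'I_n -> R), (forall i, 0 <= t i <= T) ->
    exists m s : R, 0 <= s /\ normal_law m s (fun w => \sum_i c i * X (t i) w).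

Definition fractional_brownian_motion (H T : R) (X : R -> {RV P >-> R}) : Prop :=
  [/\ gaussian_process T X,
      forall t, 0 <= t <= T -> ('E_P[X t] = 0)%E
    & forall t tau, 0 <= t <= T -> 0 <= tau <= T ->
        covariance P (X t) (X tau) = (fbm_cov H t tau)%:E].

(* An item (c, (u, v)) stands for the term c * 1_]u, v]. *)
Definition step_fun (s : seq (R * (R * R))) (t : R) : R :=
  \sum_(p <- s) p.1 * \1_(`]p.2.1, p.2.2]) t.

Definition step_within (a b : R) (s : seq (R * (R * R))) : bool :=
  all (fun p => (a <= p.2.1) && (p.2.1 <= p.2.2) && (p.2.2 <= b)) s.

Definition step_integral (B : R -> Omega -> R) (s : seq (R * (R * R)))
    (w : Omega) : R :=
  \sum_(p <- s) p.1 * (B p.2.2 w - B p.2.1 w).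

(* [I] is (a version of) the Ito integral of the deterministic function [f] in
   L2([a, b]) against [B]: the L2(P)-limit of the integrals of step functions
   converging to [f] in L2([a, b]). *)
Definition ito_integral (B : R -> Omega -> R) (a b : R) (f : R -> R)
    (I : {RV P >-> R}) : Prop :=
  [/\ measurable_fun `[a, b] f,
      (\int[mu]_(t in `[a, b]) ((f t) ^+ 2)%:E < +oo)%E
    & exists s : nat -> seq (R * (R * R)),
      [/\ forall n, step_within a b (s n),
          (fun n => \int[mu]_(t in `[a, b])
             ((f t - step_fun (s n) t) ^+ 2)%:E)%E @ \oo --> 0%E
        & (fun n => \int[P]_w
             ((I w - step_integral B (s n) w) ^+ 2)%:E)%E @ \oo --> 0%E]].

Definition spectral_approx (T : R) (L : nat) (M : 'M[R]_L)
    (V : 'I_L -> Omega -> R) (t : R) (w : Omega) : R :=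
  \sum_(i < L) \sum_(j < L) M i j * V j w * legendre T i t.

Definition mean_square_error (T : R) (X Y : R -> Omega -> R) : \bar R :=
  (\int[P]_w \int[mu]_(t in `[0%R, T]) ((X t w - Y t w) ^+ 2)%:E)%E.

End Processes.

(* Main.v *)
(* Let e_ij(t, x) = P_i(t) P_j(x), an orthonormal family of L2([0,T]^2).  By the Ito
   isometry applied at each fixed t to B_H(t) - sum_ij M_ij V_j P_i(t), and by
   Tonelli, the mean square error attached to an arbitrary matrix M is
   ||k_H - sum_ij M_ij e_ij||^2 = ||k_H||^2 - ||K||^2 + ||K - M||^2, where K is the
   matrix of the coefficients <k_H, e_ij>.  The isometry for B_H(t) itself, together
   with E B_H(t)^2 = t^2H, gives ||k_H||^2.  For step functions the isometry follows
   by polarization from E (B_t - B_s)^2 = |t - s| alone. *)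
Require Import Defs.
From HB Require Import structures.
From mathcomp Require Import all_boot all_order all_algebra.
From mathcomp Require Import all_classical all_reals all_analysis.
From mathcomp Require Import measurable_realfun zify ring lra.
Import Order.TTheory GRing.Theory Num.Theory.
Import numFieldNormedType.Exports.
Local Open Scope classical_set_scope.
Local Open Scope ring_scope.

(** The kernel involves a function selected by [get], so its norm is not computed from the series.
    Two facts about k_H are needed: joint measurability, which comes from the continuity of real
    analytic functions, and a finite L2 norm, which comes back from the process because the slice
    norms are the variances t^2H. Finiteness is what allows the square of k_H minus a finite sum to
    be expanded and integrated term by term. Correlations between B_H(t) and the V_j are not
    computed on the probability side. For fixed t the whole error is a single Ito integral by
    linearity, and the isometry, used as an equality of norms, carries it to L2([0,T]), where the
    cross terms become entries of K. Brownian motion under P and the indicators of ]-oo, t] under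
    Lebesgue measure are treated alike, as families whose increments have square integral |t - u|.
    One computation then serves both sides of the isometry for step functions. The value |t - u| is
    derived from the normal law, hence the Gaussian integral below; orthonormality is derived from
    the explicit coefficients l_ik, hence the partial fractions. *)

Section Legendre.
Set Implicit Arguments.
Unset Strict Implicit.
Context {R : realType}.
Local Notation mu := (@lebesgue_measure R).
Local Notation l := (@legendre_coeff R).

(** * Orthonormality of the Legendre polynomials on [0, T] *)

Lemma prod_natD_fact (i k : nat) :
  (\prod_(j < i) (k + j.+1)%:R) * k`!%:R = (k + i)`!%:R :> R.
Proof.
elim: i => [|i IH]; first by rewrite big_ord0 mul1r addn0.
by rewrite big_ord_recr/= mulrAC IH addnS factS -natrM mulnC.
Qed.

(** The factors with m < k contribute (-1)^k k!, those with m > k contribute (i - k)!. The product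
    is the Lagrange denominator of the node -k among 0, -1, ..., -i. *)
Lemma prod_rangeB_fact (i k : nat) : (k <= i)%N ->
  \prod_(m < i.+1 | (m : nat) != k) (m%:R - k%:R)
    = (-1) ^+ k * k`!%:R * (i - k)`!%:R :> R.
Proof.
move=> ki.
rewrite -(big_mkord (fun m => m != k) (fun m => m%:R - k%:R)).
rewrite (big_cat_nat (n := k)) ?leqW//=; congr (_ * _).
  rewrite big_mkcond/= big_seq.
  rewrite (eq_bigr (fun m => - (k - m)%:R)); last first.
    move=> m; rewrite mem_index_iota => /= mk.
    by rewrite ltn_eqF//= natrB ?opprB// ltnW.
  rewrite -big_seq big_mkord (reindex_inj rev_ord_inj)/=.
  elim: k {ki} => [|k IH]; first by rewrite big_ord0 mul1r.
  rewrite big_ord_recr/= subnn subn0 (eq_bigr (fun m : 'I_k => - (k - (k - m.+1))%:R)).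
    by rewrite IH factS natrM exprS; ring.
  by move=> m _; rewrite subSS; congr (- _%:R); have := ltn_ord m; lia.
rewrite big_ltn_cond ?ltnS//= eqxx/= big_mkcond/= big_seq.
rewrite (eq_bigr (fun m => (m - k)%:R)); last first.
  move=> m; rewrite mem_index_iota => /andP[km _].
  by rewrite gtn_eqF//= natrB// ltnW.
rewrite -big_seq -{1}(add0n k.+1) big_addn big_mkord subSS.
rewrite fact_prod big_add1 big_mkord natr_prod.
by apply: eq_bigr => m _; rewrite addnS subSn ?leq_addl// addnK.
Qed.

(** This identifies [l i k] as the residue at x = -k of the quotient of the product of the x - (j +
    1), j < i, by the product of the x + m, m <= i. *)
Lemma legendre_coeff_prod (i k : nat) : (k <= i)%N ->
  l i k * \prod_(m < i.+1 | (m : nat) != k) (m%:R - k%:R)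
    = \prod_(j < i) (- k%:R - j.+1%:R).
Proof.
move=> ki; rewrite prod_rangeB_fact//.
rewrite (eq_bigr (fun j : 'I_i => - (k + j.+1)%:R)); last first.
  by move=> j _; rewrite -opprD -natrD.
rewrite prodrN/= card_ord.
have kf : k`!%:R != 0 :> R by rewrite pnatr_eq0 -lt0n fact_gt0.
apply: (mulIf kf); rewrite -[RHS]mulrA prod_natD_fact.
have h1 : 'C(i + k, i)%:R * (i`!%:R * k`!%:R) = (k + i)`!%:R :> R.
  by rewrite -!natrM (addnC k) -(bin_fact (leq_addr k i)) addKn.
have h2 : 'C(i, i - k)%:R * ((i - k)`!%:R * k`!%:R) = i`!%:R :> R.
  by rewrite -!natrM -(bin_fact (leq_subr k i)) subKn.
have h3 : (-1) ^+ i = (-1) ^+ (i - k) * (-1) ^+ k :> R by rewrite -exprD subnK.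
rewrite /legendre_coeff -h1 -h2 h3; ring.
Qed.

(* Partial fractions: both sides, cleared of denominators, are polynomials in x
   of degree at most i that agree at the i + 1 points 0, -1, ..., -i. *)
Lemma legendre_partial_fractions (i : nat) (x : R) : 0 < x ->
  \sum_(k < i.+1) l i k / (x + k%:R)
    = (\prod_(j < i) (x - j.+1%:R)) / \prod_(k < i.+1) (x + k%:R).
Proof.
move=> x0.
pose p : {poly R} := \sum_(k < i.+1) (l i k)%:P *
    (\prod_(m < i.+1 | (m : nat) != k) ('X - (- m%:R)%:P))
  - \prod_(j < i) ('X - (j.+1%:R)%:P).
have sp : (size p <= i.+1)%N.
  rewrite (leq_trans (size_polyD _ _))// geq_max size_polyN; apply/andP; split.
    apply: (leq_trans (size_sum _ _ _)); apply/bigmax_leqP => k _.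
    rewrite mul_polyC (leq_trans (size_scale_leq _ _))//.
    rewrite -big_filter size_prod_XsubC size_filter ltnS.
    have -> : count (fun m : 'I_i.+1 => (m : nat) != k) (index_enum 'I_i.+1) = i.
      rewrite -sum1_count (eq_bigl (mem (predC1 k))).
        by rewrite sum1_card cardC1 card_ord.
      by move=> m; rewrite !inE.
    by [].
  by rewrite size_prod_XsubC /index_enum -enumT size_enum_ord.
have p0 : p = 0.
  apply: (@roots_geq_poly_eq0 _ p [seq - (m%:R : R) | m : 'I_i.+1]).
  - apply/allP => _ /mapP[k _ ->]; rewrite rootE /p !hornerE.
    rewrite horner_sum (@bigD1 R _ _ _ k)//= [X in _ + X - _]big1 ?addr0; last first.
      move=> m mk; rewrite hornerM horner_prod (bigD1 k)/=; last by rewrite eq_sym.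
      by rewrite hornerXsubC opprK addNr mul0r mulr0.
    rewrite hornerM hornerC !horner_prod.
    rewrite [X in l i k * X](_ : _ = \prod_(m < i.+1 | (m : nat) != k) (m%:R - k%:R)).
      rewrite legendre_coeff_prod ?subr_eq0; last by rewrite -ltnS.
      apply/eqP.
      by apply: eq_bigr => j _; rewrite hornerXsubC.
    by apply: eq_bigr => j _; rewrite hornerXsubC opprK addrC.
  - rewrite map_inj_uniq; first by rewrite enum_uniq.
    by move=> a b /oppr_inj/eqP; rewrite eqr_nat => /eqP/val_inj.
  - by rewrite size_map size_enum_ord.
have xk k : x + k%:R != 0 by rewrite gt_eqF// ltr_wpDr.
have D0 : \prod_(k < i.+1) (x + k%:R) != 0 by apply/prodf_neq0 => k _.
apply: (mulIf D0); rewrite divfK// mulr_suml.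
have := congr1 (horner^~ x) p0.
rewrite /p !hornerE horner_sum => /eqP; rewrite subr_eq0 => /eqP.
rewrite horner_prod; under [X in _ = X -> _]eq_bigr do rewrite hornerXsubC.
move=> <-; apply: eq_bigr => k _.
rewrite hornerM hornerC horner_prod (bigD1 k)//=.
rewrite -mulrA; congr (_ * _); rewrite mulrA mulVf// mul1r.
by apply: eq_bigr => m _; rewrite hornerXsubC opprK.
Qed.

(** The sum is the integral over [0, 1] of x^m times the shifted Legendre polynomial with
    coefficients l_ik. Partial fractions are taken at x = m + 1, where the factor j = m of the
    numerator vanishes as soon as m < i. *)
Lemma legendre_moment (i m : nat) : (m <= i)%N ->
  \sum_(k < i.+1) l i k / (k + m).+1%:R
    = if m == i then ((2 * i).+1%:R * l i i)^-1 else 0.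
Proof.
move=> mi.
have mk k : (k + m).+1%:R = m.+1%:R + k%:R :> R by rewrite -natrD addSn addnC.
under eq_bigr => k _ do rewrite mk.
rewrite legendre_partial_fractions//.
case: eqP => [->|/eqP im]; last first.
  have {mi im} mi : (m < i)%N by rewrite ltn_neqAle im.
  by rewrite (bigD1 (Ordinal mi))//= subrr !mul0r.
(* For m = i the numerator is i! and the denominator is (2i + 1)! / i!, while l_ii is the central
   binomial coefficient C(2i, i). *)
have -> : \prod_(j < i) (i.+1%:R - j.+1%:R) = i`!%:R :> R.
  have := prod_natD_fact i 0; rewrite mulr1 => <-.
  rewrite (reindex_inj rev_ord_inj)/=; apply: eq_bigr => j _.
  by rewrite -natrB ?ltnS ?leq_subr// subSS subKn.
have e1 := prod_natD_fact i.+1 i.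
rewrite (eq_bigr (fun j : 'I_i.+1 => (i + j.+1)%:R)); last first.
  by move=> j _; rewrite -natrD addSnnS.
rewrite /legendre_coeff subnn bin0 mulr1 expr0 mul1r.
have h1 : 'C(i + i, i)%:R * (i`!%:R * i`!%:R) = (i + i)`!%:R :> R.
  by rewrite -!natrM -(bin_fact (leq_addr i i)) addKn.
have F0 (n : nat) : n`!%:R != 0 :> R by rewrite pnatr_eq0 -lt0n fact_gt0.
move: e1; rewrite addnS factS natrM -h1 mul2n -addnn.
set P := \prod_(_ < _) _; set c := 'C(_, _)%:R; set f := i`!%:R => e1.
have f0 : f != 0 by exact: F0.
have n0 : (i + i).+1%:R != 0 :> R by rewrite pnatr_eq0.
have c0 : c != 0.
  by apply/eqP => c0; move: (F0 (i + i)); rewrite -h1 -/c c0 mul0r eqxx.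
have -> : P = (i + i).+1%:R * c * f.
  by apply: (mulIf f0); rewrite e1; ring.
by rewrite [in LHS]invfM mulrC -mulrA mulVf ?mulr1.
Qed.

Definition legendre_poly (T : R) (i : nat) : {poly R} :=
  Num.sqrt ((2 * i + 1)%:R / T) *:
    \sum_(k < i.+1) (l i k / T ^+ k) *: 'X^k.

Lemma legendreE (T : R) (i : nat) : legendre T i = horner (legendre_poly T i).
Proof.
apply/funext => t; rewrite /legendre /legendre_poly hornerZ horner_sum.
congr (_ * _); apply: eq_bigr => k _.
by rewrite hornerZ hornerXn mulrA mulrAC.
Qed.

Lemma continuous_legendre (T : R) (i : nat) : continuous (legendre T i).
Proof. by rewrite legendreE; exact: continuous_horner. Qed.

Lemma integral_deriv_horner (q : {poly R}) (T : R) : 0 < T ->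
  (\int[mu]_(t in `[0%R, T]) (q^`().[t])%:E = (q.[T] - q.[0])%:E)%E.
Proof.
move=> T0.
have cq (r : {poly R}) := @continuous_horner R r.
have dq (r : {poly R}) x : derivable (horner r) x 1 by exact: derivable_horner.
rewrite (@continuous_FTC2 _ _ (horner q) _ _ T0)//.
- by apply: continuous_subspaceT => x; exact: cq.
- split => //; first exact/cvg_at_right_filter/cq.
  exact/cvg_at_left_filter/cq.
- by move=> t _; rewrite -derivE.
Qed.

Lemma integral_legendreM (T : R) (i j : nat) : 0 < T ->
  (\int[mu]_(t in `[0%R, T]) (legendre T i t * legendre T j t)%:E
   = ((i == j)%:R)%:E)%E.
Proof.
move=> T0; wlog ji : i j / (j <= i)%N.
  move=> W; case: (leqP j i) => [|/ltnW] ij; first exact: W.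
  by rewrite eq_sym -(W j i ij); apply: eq_integral => t _; rewrite mulrC.
pose s n : R := Num.sqrt ((2 * n + 1)%:R / T).
have T0' : T != 0 by rewrite gt_eqF.
(* An antiderivative of the product with q(0) = 0. At T the inner sum over k is the moment of order
   m of P_i; since m <= j <= i, only m = i can survive, which forces j = i. *)
pose q : {poly R} := (s i * s j) *: \sum_(m < j.+1) \sum_(k < i.+1)
  (l j m * l i k / T ^+ (k + m) / (k + m).+1%:R) *: 'X^((k + m).+1).
have qE : q^`() = legendre_poly T i * legendre_poly T j.
  rewrite /q derivZ -scalerAl -scalerAr scalerA; congr (_ *: _).
  rewrite linear_sum/= mulr_sumr; apply: eq_bigr => m _.
  rewrite linear_sum/= mulr_suml; apply: eq_bigr => k _.
  rewrite derivZ derivXn/= -scalerMnr scalerMnl -mulr_natr divfK ?pnatr_eq0//.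
  rewrite -[RHS]scalerAl -[in RHS]scalerAr [RHS]scalerA -[in RHS]exprD.
  by congr (_ *: _); rewrite exprD; field; rewrite !expf_neq0.
transitivity (\int[mu]_(t in `[0%R, T]) (q^`().[t])%:E)%E.
  by apply: eq_integral => t _; rewrite qE hornerM !legendreE.
rewrite integral_deriv_horner//; congr EFin.
have -> : q.[0] = 0.
  rewrite /q hornerZ horner_sum big1 ?mulr0// => m _.
  rewrite horner_sum big1// => k _.
  by rewrite hornerZ hornerXn expr0n/= mulr0.
rewrite subr0 /q hornerZ horner_sum.
have term m k : l j m * l i k / T ^+ (k + m) / (k + m).+1%:R * T ^+ (k + m).+1
    = l j m * T * (l i k / (k + m).+1%:R).
  have Tn0 : T ^+ (k + m) != 0 by rewrite expf_neq0.
  rewrite exprS -[LHS](mulrC (T * _)); move: (_%:R^-1) => n.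
  by field.
under eq_bigr => m _.
  rewrite horner_sum; under eq_bigr => k _ do rewrite hornerZ hornerXn term.
  rewrite -mulr_sumr legendre_moment; last by rewrite (leq_trans _ ji)// -ltnS.
  over.
case: (eqVneq i j) ji => [<- _|ij ji]; last first.
  rewrite big1 ?mulr0// => m _; rewrite ifN ?mulr0//.
  by rewrite neq_ltn (leq_ltn_trans _ (_ : (j < i)%N))// ?ltn_neqAle 1?eq_sym ?ij// -ltnS.
rewrite (bigD1 ord_max)//= eqxx big1 ?addr0; last first.
  by move=> m mi; rewrite ifN ?mulr0//; apply: contra mi => /eqP mi; apply/eqP/val_inj.
have l0 : l i i != 0.
  rewrite /legendre_coeff subnn bin0 mulr1 expr0 mul1r pnatr_eq0 -lt0n.
  by rewrite bin_gt0 leq_addr.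
have n0 : (2 * i).+1%:R != 0 :> R by rewrite pnatr_eq0.
rewrite -expr2 sqr_sqrtr; last by rewrite divr_ge0// ltW.
rewrite addn1; move: (_.+1%:R) n0 => n n0.
by field; rewrite n0 T0' l0.
Qed.

End Legendre.

(** * Joint measurability of the kernel *)

Section KernelMeasurable.
Set Implicit Arguments.
Unset Strict Implicit.
Context {R : realType}.

(** Geometric domination: |a_n h^n| <= M q^n with q = |h| / r <= 1/2. The bound does not depend on
    N, so it passes to the sum of the series. *)
Lemma pseries_head_bound (a : nat -> R) (r M h : R) (N : nat) :
  0 < r -> (forall n, `|a n * r ^+ n| <= M) -> `|h| <= r / 2 ->
  `|pseries a h N.+1 - a 0%N| <= 2 * M / r * `|h|.
Proof.
move=> r0 aM hr.
have M0 : 0 <= M by rewrite (le_trans _ (aM 0%N)).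
pose q := `|h| / r.
have q0 : 0 <= q by rewrite divr_ge0// ltW.
have q2 : q <= 2^-1 by rewrite ler_pdivrMr// mulrC.
have term n : `|a n * h ^+ n| <= M * q ^+ n.
  rewrite (_ : `|a n * h ^+ n| = `|a n * r ^+ n| * q ^+ n).
    by rewrite ler_wpM2r ?exprn_ge0.
  rewrite !normrM !normrX (gtr0_norm r0) /q expr_div_n; field.
  by rewrite expf_neq0// gt_eqF.
(* The last factor is the sum of 2^-n for n < N, which makes the bound inductive. *)
suff H : `|pseries a h N.+1 - a 0%N| <= M * q * (2 - 2 * 2^-1 ^+ N).
  rewrite (le_trans H)// (_ : 2 * M / r * `|h| = M * q * 2); last first.
    by rewrite /q; ring.
  apply: ler_wpM2l; first exact: mulr_ge0.
  by rewrite lerBlDr lerDl mulr_ge0// exprn_ge0.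
elim: N => [|N IH].
  by rewrite /pseries /series/= big_nat1 !expr0 !mulr1 !subrr normr0 mulr0.
have -> : pseries a h N.+2 - a 0%N
    = (pseries a h N.+1 - a 0%N) + a N.+1 * h ^+ N.+1.
  by rewrite /pseries /series/= big_nat_recr//= addrAC.
rewrite (le_trans (ler_normD _ _))// (le_trans (lerD IH (term _)))//.
have qN : q ^+ N <= 2^-1 ^+ N by rewrite lerXn2r// nnegrE.
have := ler_wpM2l (mulr_ge0 M0 q0) qN.
rewrite !exprS; lra.
Qed.

(** The hypothesis only gives pointwise convergence of the expansion near x. Convergence at the
    single point r already bounds all a_n r^n, and the previous lemma then bounds |f(x + h) - f(x)|
    by a multiple of |h|. *)
Lemma real_analytic_continuous (D : set R) (f : R -> R) :
  real_analytic_on D f -> forall x, D x -> {for x, continuous f}.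
Proof.
move=> fD x /fD[a afx].
have [e /= e0 He] : exists2 e : R, 0 < e & forall h, `|h| < e ->
    pseries a h @ \oo --> f (x + h).
  move: afx => /nbhs_ballP[e /= e0 He]; exists e => // h he.
  rewrite -{1}(addKr x h) [- x + _]addrC; apply: He.
  by rewrite /ball/= opprD addNKr normrN.
pose r := e / 2.
have r0 : 0 < r by rewrite divr_gt0.
have rE : `|r| < e by rewrite gtr0_norm// /r; lra.
have [M aM] : exists M, forall n, `|a n * r ^+ n| <= M.
  have /cvgP/cvg_series_bounded[K [Kr HK]] := He r rE.
  exists (K + 1) => n; have : K < K + 1 by rewrite ltrDl.
  by move=> /HK/(_ n I).
have fx : f x = a 0%N.
  have := He 0; rewrite normr0 addr0 => /(_ e0) H.
  suff H0 : pseries a 0 @ \oo --> a 0%N by exact: (cvg_unique _ H H0).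
  rewrite -(cvg_shiftS (pseries a 0)) (_ : [sequence _]_n = cst (a 0%N)).
    exact: cvg_cst.
  apply/funext => n /=; rewrite /pseries /series/= big_nat_recl//= expr0 mulr1.
  by rewrite big1 ?addr0// => i _; rewrite expr0n/= mulr0.
have bnd h : `|h| <= r / 2 -> `|f (x + h) - f x| <= 2 * M / r * `|h|.
  move=> hr; have he : `|h| < e by rewrite (le_lt_trans hr)// /r; lra.
  have := He h he; rewrite -(cvg_shiftS (pseries a h)) => H.
  rewrite fx.
  have H2 : `|pseries a h n.+1 - a 0%N| @[n --> \oo] --> `|f (x + h) - a 0%N|.
    by apply: cvg_norm; apply: cvgB H _; exact: cvg_cst.
  rewrite -(cvg_lim _ H2)//; apply: limr_le; first exact: cvgP H2.
  by apply: nearW => n; exact: pseries_head_bound.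
apply/cvgrPdist_le => eps eps0.
have M0 : 0 <= M by rewrite (le_trans _ (aM 0%N)).
(* The added 1 keeps C positive when M = 0. *)
pose C := 2 * M / r + 1.
have C0 : 0 < C by rewrite ltr_pwDr// divr_ge0 ?mulr_ge0// ltW.
near=> y.
have -> : `|f x - f y| = `|f (x + (y - x)) - f x|.
  by rewrite [x + _]addrC subrK -normrN opprB.
have yx : `|y - x| <= r / 2.
  rewrite -normrN opprB; near: y; apply: cvgr_dist_le => //.
  by rewrite divr_gt0.
rewrite (le_trans (bnd _ yx))//.
have : `|y - x| <= eps / C.
  rewrite -normrN opprB; near: y; apply: cvgr_dist_le => //.
  by rewrite divr_gt0.
rewrite ler_pdivlMr// => /(le_trans _); apply.
by rewrite mulrC ler_wpM2l// /C lerDl.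
Unshelve. all: by end_near. Qed.

(* If no analytic continuation existed, [get] would return a constant function. *)
Lemma measurable_hyp2F1 (a b c : R) :
  measurable_fun (`]-oo, 1[ : set R) (hyp2F1 a b c).
Proof.
rewrite /hyp2F1; case: (pselect (exists F, is_hyp2F1 a b c F)) => [exF|nF].
  have /= [FA _] := getPex exF.
  apply: open_continuous_measurable_fun; first exact: interval_open.
  by move=> x /set_mem; exact: real_analytic_continuous.
by rewrite getPN => [|F HF]; [exact: measurable_cst|apply: nF; exists F].
Qed.

Lemma measurable_fbm_kernel (H : R) :
  measurable_fun [set: R * R] (fun z => fbm_kernel H z.1 z.2).
Proof.
pose F := hyp2F1 (2^-1 - H) (H - 2^-1) (H + 2^-1).
(* [F] is controlled only on ]-oo, 1[, so it is extended by 0; the argument 1 - t / tau lies there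
   whenever 0 < tau < t. Division by tau is rewritten as the power -1 to reuse the measurability of
   [powR]. *)
pose G := F \_ `]-oo, 1[.
have mG : measurable_fun [set: R] G.
  by apply/(measurable_restrictT F); [exact: measurable_itv|exact: measurable_hyp2F1].
rewrite (_ : (fun z => _) = fun z : R * R => if (0 < z.2) && (z.2 < z.1) then
    fbm_const H / Gamma (H + 2^-1) * (z.1 - z.2) `^ (H - 2^-1)
    * G (1 - z.1 * z.2 `^ (-1)) else 0); last first.
  apply/funext => -[t tau]; rewrite /fbm_kernel/=.
  case: ifP => // /andP[tau0 tt]; rewrite powR_inv1 ?(ltW tau0)//.
  rewrite /G patchE mem_set//= in_itv/= ltrBlDr ltrDl divr_gt0//.
  exact: lt_trans tt.
have m1 : measurable_fun [set: R * R] (fun z => z.1) by exact: measurable_fst.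
have m2 : measurable_fun [set: R * R] (fun z => z.2) by exact: measurable_snd.
apply: measurable_fun_ifT => //.
- apply: measurable_and; exact: measurable_fun_ltr.
- apply: measurable_funM.
    apply: measurable_funM => //.
    apply: (measurableT_comp (measurable_powR _)).
    exact: measurable_funB.
  apply: (measurableT_comp mG); apply: measurable_funB => //.
  apply: measurable_funM => //.
  exact: (measurableT_comp (measurable_powR _)).
Qed.

End KernelMeasurable.

(** * Second moment of the centered normal law *)

Section NormalSecondMoment.
Set Implicit Arguments.
Unset Strict Implicit.
Context {R : realType}.
Local Notation mu := (@lebesgue_measure R).

(** The change of measure is available for the Radon-Nikodym derivative, which agrees almost
    everywhere with [normal_pdf] because both have the same integral over every measurable set. *)
Lemma ge0_integral_normal_prob (m s : R) (f : R -> \bar R) :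
  measurable_fun setT f -> (forall x, 0 <= f x)%E ->
  (\int[normal_prob m s]_x f x = \int[mu]_x (f x * (normal_pdf m s x)%:E))%E.
Proof.
move=> mf f0.
have dom := normal_prob_dominates m s.
rewrite -(Radon_Nikodym_SigmaFinite.change_of_variables dom)//.
pose g := Radon_Nikodym_SigmaFinite.f (normal_prob m s) mu.
have ig : mu.-integrable setT g := Radon_Nikodym_SigmaFinite.f_integrable dom.
have mp : measurable_fun setT (fun x => (normal_pdf m s x)%:E).
  by apply/measurable_EFinP; exact: measurable_normal_pdf.
have gp : ae_eq mu setT g (fun x => (normal_pdf m s x)%:E).
  apply: integral_ae_eq => // E _ mE.
  by rewrite -(Radon_Nikodym_SigmaFinite.f_integral dom).
apply: ge0_ae_eq_integral => //.
- by apply: emeasurable_funM => //; exact: measurable_int ig.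
- exact: emeasurable_funM.
- by move=> x _; rewrite mule_ge0//; exact: Radon_Nikodym_SigmaFinite.f_ge0.
- by move=> x _; rewrite mule_ge0// lee_fin normal_pdf_ge0.
- by apply: filterS gp => x gpx Dx; rewrite -gpx.
Qed.

Section Gauss.
Variable s : R.
Hypothesis s0 : 0 < s.
Let phi (x : R) := expR (- (x ^+ 2 / (2 * s ^+ 2))).
(** An antiderivative of (x^2 - s^2) phi, vanishing at 0 and at +oo. *)
Let G (x : R) := - (s ^+ 2 * x * phi x).

Let phi_gt0 x : 0 < phi x. Proof. exact: expR_gt0. Qed.

Let dphi (x : R) : is_derive x 1 phi (- (x / s ^+ 2) * phi x).
Proof.
rewrite /phi; apply: is_derive_eq.
by rewrite /GRing.scale/=; field; rewrite gt_eqF.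
Qed.

Let dG (x : R) : is_derive x 1 G ((x ^+ 2 - s ^+ 2) * phi x).
Proof.
have := dphi x; rewrite /G => ?; apply: is_derive_eq.
by rewrite /GRing.scale/=; field; rewrite gt_eqF.
Qed.

Let cphi : continuous phi.
Proof. by move=> x; apply/differentiable_continuous/derivable1_diffP. Qed.

Let cG : continuous G.
Proof. by move=> x; apply/differentiable_continuous/derivable1_diffP. Qed.

Let G_cvg0 : G x @[x --> +oo] --> 0.
Proof.
have inv0 : - (2 * s ^+ 4 * x^-1) @[x --> +oo] --> (0 : R).
  rewrite -oppr0 -(mulr0 (2 * s ^+ 4)); apply: cvgN; apply: cvgMr.
  by apply/gtr0_cvgV0; [exact: nbhs_pinfty_gt|exact: cvg_id].
apply: squeeze_cvgr inv0 (cvg_cst 0).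
near=> x; have x0 : 0 < x by near: x; exact: nbhs_pinfty_gt.
rewrite /G lerN2 oppr_le0 (mulr_ge0 (mulr_ge0 (sqr_ge0 _) (ltW x0)) (ltW _))// andbT.
(* From 1 + y <= exp y at y = x^2 / (2 s^2); it gives s^2 x phi(x) <= 2 s^4 / x. *)
have h : phi x * (x ^+ 2 / (2 * s ^+ 2)) <= 1.
  rewrite /phi expRN mulrC ler_pdivrMr ?expR_gt0// mul1r.
  by rewrite (le_trans _ (expR_ge1Dx _))// lerDr.
rewrite (_ : s ^+ 2 * x * phi x
  = 2 * s ^+ 4 / x * (phi x * (x ^+ 2 / (2 * s ^+ 2)))); last first.
  by field; rewrite !gt_eqF.
by rewrite ler_piMr// divr_ge0// ?mulr_ge0 ?exprn_ge0// ltW.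
Unshelve. all: by end_near. Qed.

Let cM (p : R -> R) : continuous p -> continuous (fun x => p x * phi x).
Proof. by move=> cp x; apply: cvgM; [exact: cp|exact: cphi]. Qed.

Let csq (a b : R) : continuous (fun x : R => a * x ^+ 2 + b).
Proof.
move=> x; apply: cvgD; last exact: cvg_cst.
by apply: cvgM; [exact: cvg_cst|exact: sqr_continuous].
Qed.

Let half_line_split (g : R -> R) : continuous g -> (forall x, 0 <= g x) ->
  (\int[mu]_(x in [set x | (0 <= x)%R]) (g x)%:E
    = \int[mu]_(x in `[0%R, s]) (g x)%:E + \int[mu]_(x in `[s, +oo[) (g x)%:E)%E.
Proof.
move=> cg g0; have mg : measurable_fun setT g by exact: continuous_measurable_fun.
rewrite -(@integral_itv_bndo_bndc _ _ s); last first.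
  exact/measurable_funTS/measurable_EFinP.
rewrite -set_itvcy (@itv_bndbnd_setU _ _ _ (BLeft s)) ?bnd_simp ?ltW//.
rewrite ge0_integral_setU//=.
- exact/measurable_funTS/measurable_EFinP.
- by move=> x _; rewrite lee_fin.
- rewrite disj_set2E; apply/eqP; rewrite -subset0 => x/=.
  by rewrite !in_itv/= andbT => -[/andP[_ xs]]; rewrite leNgt xs.
Qed.

Let gaussE a b x : 0 <= a * x ^+ 2 + b -> 0 <= (a * x ^+ 2 + b) * phi x.
Proof. by move=> h; rewrite mulr_ge0// ltW. Qed.

(** By symmetry it suffices to work on the half-line, cut at s where x^2 - s^2 changes sign, so that
    only nonnegative integrands are added. On [0, s] the integral of s^2 phi is larger by -G(s); on
    [s, +oo[ that of x^2 phi is larger by the same amount. *)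
Lemma integral_sqr_gauss :
  (\int[mu]_x (x ^+ 2 * phi x)%:E = \int[mu]_x (s ^+ 2 * phi x)%:E)%E.
Proof.
have phiN x : phi (- x) = phi x by rewrite /phi sqrrN.
pose g a b x := (a * x ^+ 2 + b) * phi x.
have cg a b : continuous (g a b) := cM (@csq a b).
have mg a b D : measurable_fun D (fun x => (g a b x)%:E).
  apply/measurable_EFinP/measurable_funTS.
  by apply: continuous_measurable_fun; exact: (@cg a b).
have gE1 x : x ^+ 2 * phi x = g 1 0 x by rewrite /g mul1r addr0.
have gE2 x : s ^+ 2 * phi x = g 0 (s ^+ 2) x by rewrite /g mul0r add0r.
have g1 x : 0 <= g 1 0 x by rewrite -gE1 mulr_ge0 ?sqr_ge0// ltW.
have g2 x : 0 <= g 0 (s ^+ 2) x by rewrite -gE2 mulr_ge0 ?sqr_ge0// ltW.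
under eq_integral do rewrite gE1.
under [RHS]eq_integral do rewrite gE2.
have even a b : g a b =1 g a b \o -%R by move=> x; rewrite /g/= sqrrN phiN.
rewrite !ge0_symfun_integralT// !half_line_split//.
congr (_ * _)%E.
have h1 : (\int[mu]_(x in `[0%R, s]) (g 0 (s ^+ 2) x)%:E
    = \int[mu]_(x in `[0%R, s]) (g 1 0 x)%:E + (- G s)%:E)%E.
  rewrite -[X in (_ + X)%E](_ : \int[mu]_(x in `[0%R, s]) (g (- 1) (s ^+ 2) x)%:E
    = _)%E.
    rewrite -ge0_integralD//=.
    - by apply: eq_integral => x _; rewrite -EFinD; congr EFin; rewrite /g; ring.
    - by move=> x _; rewrite lee_fin.
    - exact: mg.
    - move=> x /=; rewrite in_itv/= => /andP[x0 xs].
      rewrite lee_fin gaussE// mulN1r addrC subr_ge0.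
      by rewrite ler_sqr ?nnegrE// ltW.
    - exact: mg.
  rewrite (@continuous_FTC2 _ _ (- G)) ?fctE//.
  - by rewrite /= -EFinB /G !(mulr0, mul0r, oppr0, subr0).
  - exact/continuous_subspaceT/cg.
  - split.
    + by move=> x _; apply: derivableN.
    + by apply/cvg_at_right_filter; apply: cvgN; exact: cG.
    + by apply/cvg_at_left_filter; apply: cvgN; exact: cG.
  - move=> x _; rewrite derive1E.
    by rewrite (@derive_val _ _ _ _ _ _ _ (is_deriveN (dG x))) /g; ring.
have h2 : (\int[mu]_(x in `[s, +oo[) (g 1 0 x)%:E
    = \int[mu]_(x in `[s, +oo[) (g 0 (s ^+ 2) x)%:E + (- G s)%:E)%E.
  rewrite -[X in (_ + X)%E](_ : \int[mu]_(x in `[s, +oo[) (g 1 (- s ^+ 2) x)%:E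
    = _)%E.
    rewrite -ge0_integralD//=.
    - by apply: eq_integral => x _; rewrite -EFinD; congr EFin; rewrite /g; ring.
    - by move=> x _; rewrite lee_fin.
    - exact: mg.
    - move=> x /=; rewrite in_itv/= andbT => sx.
      rewrite lee_fin gaussE// mul1r subr_ge0.
      by rewrite ler_sqr ?nnegrE// ltW// (lt_le_trans s0).
    - exact: mg.
  rewrite (@ge0_continuous_FTC2y _ _ G _ 0) ?sub0e//.
  - move=> x sx; rewrite gaussE// mul1r subr_ge0.
    by rewrite ler_sqr ?nnegrE// ltW// (lt_le_trans s0).
  - exact/continuous_subspaceT/cg.
  - exact/cvg_at_right_filter/cG.
  - by move=> x _; rewrite derive1E (@derive_val _ _ _ _ _ _ _ (dG x)) /g mul1r.
by rewrite h1 h2 -addeA [(_ + (- G s)%:E)%E]addeC.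
Qed.

End Gauss.

Lemma normal_second_moment (s : R) : 0 < s ->
  (\int[normal_prob 0 s]_x (x ^+ 2)%:E = (s ^+ 2)%:E)%E.
Proof.
move=> s0; have sN0 : s != 0 by rewrite gt_eqF.
rewrite ge0_integral_normal_prob//; last first.
  - by move=> x; rewrite lee_fin sqr_ge0.
  - by apply/measurable_EFinP; exact: measurable_funX.
have pdfE x : normal_pdf 0 s x
    = normal_peak s * expR (- (x ^+ 2 / (2 * s ^+ 2))).
  by rewrite normal_pdfE// /normal_fun subr0 mulNr mulr_natl.
have pk := ltW (normal_peak_gt0 sN0).
pose phi (x : R) := expR (- (x ^+ 2 / (2 * s ^+ 2))).
have phi0 x : 0 <= phi x := expR_ge0 _.
have mphi : measurable_fun setT phi.
  apply: measurableT_comp => //; apply: measurable_funN.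
  by apply: measurable_funM => //; exact: exprn_measurable.
under eq_integral do rewrite -EFinM pdfE mulrCA EFinM.
rewrite ge0_integralZl//; last 2 first.
  - by apply/measurable_EFinP/measurable_funM => //; exact: exprn_measurable.
  - by move=> x _; rewrite lee_fin mulr_ge0 ?sqr_ge0.
rewrite (integral_sqr_gauss s0) -ge0_integralZl//; last 2 first.
  - by apply/measurable_EFinP/measurable_funM.
  - by move=> x _; rewrite lee_fin mulr_ge0 ?sqr_ge0.
under eq_integral do rewrite -EFinM mulrCA -pdfE EFinM.
rewrite integralZl//; last exact: integrable_normal_pdf.
by rewrite integral_normal_pdf mule1.
Qed.

End NormalSecondMoment.

Local Notation sqint mu D f := (\int[mu]_(t in D) ((f t) ^+ 2)%:E)%E.

(** * Square integrals and their limits *)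

Section SquareIntegrals.
Set Implicit Arguments.
Unset Strict Implicit.
Context d (T : measurableType d) (R : realType).
Variables (mu : {measure set T -> \bar R}) (D : set T).
Hypothesis mD : measurable D.

Lemma measurable_sqE (f : T -> R) : measurable_fun D f ->
  measurable_fun D (fun t => ((f t) ^+ 2)%:E).
Proof. by move=> mf; apply/measurable_EFinP; exact: measurable_funX. Qed.

Lemma sqint_ge0 (f : T -> R) : (0 <= sqint mu D f)%E.
Proof. by apply: integral_ge0 => t _; rewrite lee_fin sqr_ge0. Qed.

Lemma sqintB_sym (f g : T -> R) :
  sqint mu D (fun t => f t - g t) = sqint mu D (fun t => g t - f t).
Proof. by apply: eq_integral => t _; rewrite -sqrrN opprB. Qed.

(** Weighted Young inequality for f = g + (f - g). A leading factor 1 + e, arbitrarily close to 1,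
    is what makes norms pass exactly to the limit. *)
Lemma sqint_le_split (e : R) (f g : T -> R) : 0 < e ->
  measurable_fun D f -> measurable_fun D g ->
  (sqint mu D f <= (1 + e)%:E * sqint mu D g
     + (1 + e^-1)%:E * sqint mu D (fun t => (f t - g t)%R))%E.
Proof.
move=> e0 mf mg; have ei0 : 0 < e^-1 by rewrite invr_gt0.
have mfg : measurable_fun D (fun t => f t - g t) by exact: measurable_funB.
have c1 : (0 <= (1 + e)%:E)%E by rewrite lee_fin addr_ge0// ltW.
have c2 : (0 <= (1 + e^-1)%:E)%E by rewrite lee_fin addr_ge0// ltW.
rewrite -!ge0_integralZl//;
  try by [exact: measurable_sqE | move=> t _; rewrite lee_fin sqr_ge0].
rewrite -ge0_integralD//; first last.
- by apply: measurable_funeM; exact: measurable_sqE.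
- by move=> t _; rewrite mule_ge0// lee_fin sqr_ge0.
- by apply: measurable_funeM; exact: measurable_sqE.
- by move=> t _; rewrite mule_ge0// lee_fin sqr_ge0.
apply: ge0_le_integral => //.
- by move=> t _; rewrite lee_fin sqr_ge0.
- exact: measurable_sqE.
- by apply: emeasurable_funD; apply: measurable_funeM; exact: measurable_sqE.
move=> t _; rewrite -!EFinM -EFinD lee_fin -subr_ge0.
rewrite (_ : _ - _ = e^-1 * (e * g t - (f t - g t)) ^+ 2).
  by rewrite mulr_ge0 ?sqr_ge0// ltW.
by field; rewrite gt_eqF.
Qed.

End SquareIntegrals.

Lemma cvge0_near_lt (R : realType) (u : nat -> \bar R) (e : R) : 0 < e ->
  u @ \oo --> 0%E -> \forall n \near \oo, (u n < e%:E)%E.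
Proof.
move=> e0 /fine_cvgP[fu cu].
have := cvgr_lt _ cu _ e0 => cu'.
near=> n; rewrite -[ltLHS]fineK ?lte_fin; near: n; first exact: cu'.
exact: fu.
Unshelve. all: by end_near. Qed.

Section SquareIntegralLimit.
Set Implicit Arguments.
Unset Strict Implicit.
Context d1 (T1 : measurableType d1) d2 (T2 : measurableType d2) (R : realType).
Variables (m1 : {measure set T1 -> \bar R}) (m2 : {measure set T2 -> \bar R}).
Variables (D1 : set T1) (D2 : set T2) (X : T1 -> R) (f : T2 -> R).
Variables (S : nat -> T1 -> R) (g : nat -> T2 -> R).
Hypotheses (mD1 : measurable D1) (mD2 : measurable D2).
Hypotheses (mX : measurable_fun D1 X) (mf : measurable_fun D2 f).
Hypotheses (mS : forall n, measurable_fun D1 (S n))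
  (mg : forall n, measurable_fun D2 (g n)).
Hypotheses (Sg : forall n, sqint m1 D1 (S n) = sqint m2 D2 (g n))
  (XS : (fun n => sqint m1 D1 (fun t => X t - S n t)) @ \oo --> 0%E)
  (fg : (fun n => sqint m2 D2 (fun t => f t - g n t)) @ \oo --> 0%E).

(** The two functions live on different spaces and are linked only by approximants of equal norm.
    Exchanging the two sides yields the reverse inequality. *)
Lemma sqint_limit_le : (sqint m1 D1 X <= sqint m2 D2 f)%E.
Proof.
have := sqint_ge0 m2 D2 f; case E : (sqint m2 D2 f) => [a| |]//; last first.
  by move=> _; rewrite leey.
rewrite lee_fin => a0; apply/lee_addgt0Pr => eta eta0.
(* Two applications of the splitting inequality end at (1 + e)((1 + e) a + e/2) + e/2, which is at
   most a + e (3 a + 2) when e <= 1. The choice of [del] below makes each error term e/2. *)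
pose e := Num.min 1 (eta / (3 * a + 2)).
have p0 : 0 < 3 * a + 2 by lra.
have e0 : 0 < e by rewrite lt_min ltr01 divr_gt0.
have e1 : e <= 1 by rewrite ge_min lexx.
have ee : e * (3 * a + 2) <= eta.
  by rewrite -ler_pdivlMr// ge_min lexx orbT.
pose C := 1 + e^-1; pose del := e / (2 * C).
have C0 : 0 < C by rewrite addr_gt0// invr_gt0.
have del0 : 0 < del by rewrite divr_gt0// mulr_gt0.
have Cd : C * del = e / 2 by rewrite /del; field; rewrite gt_eqF.
have [n [Xn fn]] : exists n, (sqint m1 D1 (fun t => X t - S n t) < del%:E)%E /\
    (sqint m2 D2 (fun t => f t - g n t) < del%:E)%E.
  near \oo => n; exists n; split; near: n.
    exact: cvge0_near_lt XS.
  exact: cvge0_near_lt fg.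
rewrite (le_trans (sqint_le_split m1 mD1 e0 mX (mS n)))// Sg.
have h := sqint_le_split m2 mD2 e0 (mg n) mf.
rewrite sqintB_sym E in h.
have H : (sqint m2 D2 (g n) <= ((1 + e) * a + C * del)%:E)%E.
  rewrite (le_trans h)// [leRHS]EFinD !EFinM leeD2l// lee_wpmul2l//.
    by rewrite lee_fin ltW.
  exact: ltW.
have H2 : ((1 + e)%:E * sqint m2 D2 (g n)
    <= ((1 + e) * ((1 + e) * a + C * del))%:E)%E.
  by rewrite EFinM lee_wpmul2l// lee_fin addr_ge0// ltW.
have H3 : (C%:E * sqint m1 D1 (fun t => X t - S n t) <= (C * del)%:E)%E.
  by rewrite EFinM lee_wpmul2l// ?lee_fin ltW.
rewrite (le_trans (leeD H2 H3))// -!EFinD lee_fin Cd.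
have ea : e * e * a <= e * a by rewrite ler_wpM2r// ler_piMl// ltW.
have ee2 : e * e <= e by rewrite ler_piMl// ltW.
lra.
Unshelve. all: by end_near. Qed.

End SquareIntegralLimit.

(** * Ito isometry: step functions, then the general case *)

Section Increments.
Set Implicit Arguments.
Unset Strict Implicit.
Context {R : realType}.

(* Bilinear form of increments when [E (X_t - X_s)^2 = |t - s|], by polarization:
   2 (X_v - X_u) (X_v' - X_u') = (X_v - X_u')^2 + (X_u - X_v')^2
     - (X_v - X_v')^2 - (X_u - X_u')^2. *)
Definition increment_form (p q : R * (R * R)) : R :=
  p.1 * q.1 / 2 * (`|p.2.2 - q.2.1| + `|p.2.1 - q.2.2|
                   - `|p.2.2 - q.2.2| - `|p.2.1 - q.2.1|).

(** Stated for an arbitrary family on an arbitrary measure space, so that it applies to Brownian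
    motion under P and to indicators under Lebesgue measure. Overlapping intervals are allowed: the
    double sum of increment forms handles them. *)
Lemma sqint_increments d (T : measurableType d) (mu : {measure set T -> \bar R})
    (D : set T) (X : R -> T -> R) (b : R) (s : seq (R * (R * R))) :
  measurable D ->
  (forall t, 0 <= t <= b -> measurable_fun D (X t)) ->
  (forall t u, 0 <= t <= b -> 0 <= u <= b ->
    sqint mu D (fun w => X t w - X u w) = `|t - u|%:E) ->
  step_within 0 b s ->
  sqint mu D (fun w => \sum_(p <- s) p.1 * (X p.2.2 w - X p.2.1 w))
  = (\sum_(p <- s) \sum_(q <- s) increment_form p q)%:E.
Proof.
move=> mD mX iX sw; pose r (i : 'I_(size s)) := tnth (in_tuple s) i.
have rb i : 0 <= (r i).2.1 <= b /\ 0 <= (r i).2.2 <= b.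
  have /(allP sw)/andP[/andP[h1 h2] h3] := mem_tnth i (in_tuple s).
  by rewrite -/(r i) in h1 h2 h3 *; split; lra.
pose Q t u w := (X t w - X u w) ^+ 2.
have intQ t u : 0 <= t <= b -> 0 <= u <= b -> mu.-integrable D (EFin \o Q t u).
  move=> tb ub; apply/integrableP; split.
    by apply: measurable_sqE; apply: measurable_funB; exact: mX.
  under eq_integral do rewrite /= ger0_norm ?sqr_ge0//.
  by rewrite iX// ltry.
pose term (p q : R * (R * R)) w := p.1 * q.1 / 2 *
  (Q p.2.2 q.2.1 w + Q p.2.1 q.2.2 w - Q p.2.2 q.2.2 w - Q p.2.1 q.2.1 w).
have int_term i j : mu.-integrable D (EFin \o term (r i) (r j)) /\
    (\int[mu]_(w in D) (term (r i) (r j) w)%:E)%E = (increment_form (r i) (r j))%:E.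
  have [ui vi] := rb i; have [uj vj] := rb j.
  have i1 := intQ _ _ vi uj; have i2 := intQ _ _ ui vj.
  have i3 := intQ _ _ vi vj; have i4 := intQ _ _ ui uj.
  have i12 := integrableD mD i1 i2; have i123 := integrableB mD i12 i3.
  have i1234 := integrableB mD i123 i4.
  split.
    rewrite (_ : EFin \o _ = fun w => ((r i).1 * (r j).1 / 2)%:E *
       ((EFin \o Q (r i).2.2 (r j).2.1) \+ (EFin \o Q (r i).2.1 (r j).2.2)
        \- (EFin \o Q (r i).2.2 (r j).2.2)
        \- (EFin \o Q (r i).2.1 (r j).2.1)) w)%E; last by [].
    exact: integrableZl.
  under eq_integral do rewrite EFinM.
  rewrite integralZl//= (@integralB _ _ _ _ _ mD _ _ i123 i4).
  rewrite (@integralB _ _ _ _ _ mD _ _ i12 i3) (@integralD _ _ _ _ _ mD _ _ i1 i2)/=.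
  by rewrite !iX.
transitivity (\int[mu]_(w in D) (\sum_i \sum_j (term (r i) (r j) w)%:E))%E.
  apply: eq_integral => w _; rewrite big_tnth expr2 mulr_suml -sumEFin.
  apply: eq_bigr => i _; rewrite mulr_sumr -sumEFin.
  by apply: eq_bigr => j _; rewrite /term /Q -/(r i) -/(r j); congr EFin; field.
rewrite integral_sum//; last first.
  by move=> i; apply: integrable_sum => // j _; exact: (int_term i j).1.
rewrite [X in X%:E]big_tnth -sumEFin; apply: eq_bigr => i _.
rewrite integral_sum//; last by move=> j; exact: (int_term i j).1.
rewrite [X in X%:E]big_tnth -sumEFin; apply: eq_bigr => j _.
exact: (int_term i j).2.
Qed.

Lemma measurable_step_fun (s : seq (R * (R * R))) D :
  measurable_fun D (step_fun s).
Proof.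
apply/measurable_funTS/measurable_sum => p.
by apply: measurable_funM => //; exact: measurable_indic.
Qed.

Lemma sqint_step_fun (b : R) (s : seq (R * (R * R))) :
  step_within 0 b s ->
  sqint (@lebesgue_measure R) `[0%R, b] (step_fun s)
  = (\sum_(p <- s) \sum_(q <- s) increment_form p q)%:E.
Proof.
(* X_t - X_u is the indicator of ]u, t], so the step function is the step integral against this
   family. *)
move=> sw; pose X (t : R) : R -> R := \1_`]-oo, t].
have XB t u x : u <= t -> X t x - X u x = \1_`]u, t] x.
  move=> ut; rewrite /X !indicE !mem_setE !in_itv/=.
  have [xu|xu] := leP x u; first by rewrite (le_trans xu ut) subrr.
  by rewrite subr0.
rewrite -(@sqint_increments _ _ (@lebesgue_measure R) `[0%R, b] X b s)//.
- apply: eq_integral => x _; congr EFin; congr (_ ^+ 2).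
  rewrite /step_fun big_seq [RHS]big_seq; apply: eq_bigr => p /(allP sw).
  by move=> /andP[/andP[_ puv] _]; rewrite XB.
- by move=> t _; apply/measurable_funTS/measurable_indic.
- move=> t u; wlog ut : t u / u <= t => [W tb ub|tb ub].
    have [/W/(_ tb ub)//|/ltW/W/(_ ub tb)] := leP u t.
    by rewrite sqintB_sym -normrN opprB.
  transitivity (\int[@lebesgue_measure R]_(x in `[0%R, b]) (\1_`]u, t] x)%:E)%E.
    apply: eq_integral => x _; rewrite XB// indicE.
    by case: (_ \in _); rewrite ?expr1n ?expr0n.
  rewrite integral_indic// setIidl; last first.
    by move=> x /=; rewrite !in_itv/=; lra.
  rewrite [LHS](_ : _ = lebesgue_measure (`]u, t]%classic : set R))//.
  rewrite lebesgue_measure_itv/= lte_fin ger0_norm ?subr_ge0//.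
  by have [->|ut'] := eqVneq u t; [rewrite ltxx subrr|rewrite lt_neqAle ut' ut EFinB].
Qed.

End Increments.

Section BrownianIsometry.
Set Implicit Arguments.
Unset Strict Implicit.
Context {R : realType} {d : measure_display} {Omega : measurableType d}
  (P : probability Omega R).

Lemma normal_law_sqint (s : R) (X : {RV P >-> R}) : 0 < s ->
  normal_law P 0 s X -> sqint P setT X = (s ^+ 2)%:E.
Proof.
move=> s0 nX; rewrite -(normal_second_moment s0).
have mX : measurable_fun setT (X : Omega -> measurableTypeR R).
  exact: (measurable_funPT X).
pose Y : {mfun Omega >-> measurableTypeR R} :=
  HB.pack (X : Omega -> measurableTypeR R) (isMeasurableFun.Build _ _ _ _ _ mX).
transitivity (\int[distribution P Y]_x ((x ^+ 2)%R)%:E)%E.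
  rewrite ge0_integral_distribution//.
    by apply/measurable_EFinP; exact: exprn_measurable.
  by move=> y; rewrite lee_fin sqr_ge0.
apply: eq_measure_integral => A mA _.
by have := nX _ mA; rewrite gt_eqF.
Qed.

Lemma brownian_increment_sqint (T : R) (B : R -> {RV P >-> R}) (t u : R) :
  brownian_motion T B -> 0 <= t <= T -> 0 <= u <= T ->
  sqint P setT (fun w => B t w - B u w) = `|t - u|%:E.
Proof.
case=> _ _ nB _; wlog ut : t u / u <= t => [W tb ub|tb ub].
  have [/W/(_ tb ub)//|/ltW/W/(_ ub tb)] := leP u t.
  by rewrite sqintB_sym -normrN opprB.
have [->|ut'] := eqVneq u t.
  rewrite subrr normr0 integral0_eq// => w _.
  by rewrite subrr expr0n.
have {}ut : u < t by rewrite lt_neqAle ut'.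
rewrite (@normal_law_sqint (Num.sqrt (t - u)) (B t - B u)).
- by rewrite sqr_sqrtr ?subr_ge0 ?(ltW ut)// gtr0_norm// subr_gt0.
- by rewrite sqrtr_gt0 subr_gt0.
- by apply: nB => //; case/andP: ub tb => ? _ /andP[].
Qed.

Lemma measurable_step_integral (B : R -> {RV P >-> R}) (s : seq (R * (R * R))) :
  measurable_fun setT (step_integral B s).
Proof.
apply: measurable_sum => p; apply: measurable_funM => //.
exact: measurable_funB.
Qed.

(** The step functions and their integrals have the same double sum of increment forms as square
    integral; two opposite limit inequalities give the equality. *)
Lemma ito_isometry (T : R) (B : R -> {RV P >-> R}) (f : R -> R)
    (I : {RV P >-> R}) :
  brownian_motion T B -> ito_integral B 0 T f I ->
  sqint P setT I = sqint (@lebesgue_measure R) `[0%R, T] f.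
Proof.
move=> bB [mf _ [s [sw fs Is]]].
have mS n := measurable_step_integral B (s n).
have mg n : measurable_fun `[0%R, T] (step_fun (s n)).
  exact: measurable_step_fun.
have Sg n : sqint P setT (step_integral B (s n))
    = sqint (@lebesgue_measure R) `[0%R, T] (step_fun (s n)).
  rewrite (sqint_step_fun (sw n)); apply: (@sqint_increments _ _ _ _ _ _ T) => //.
  by move=> t u tb ub; exact: brownian_increment_sqint tb ub.
apply/le_anti/andP; split.
- exact: (@sqint_limit_le _ Omega _ (measurableTypeR R) R P
    (@lebesgue_measure R) setT _ I f _ _ measurableT (measurable_itv _)
    (measurable_funPT I) mf mS mg Sg Is fs).
- exact: (@sqint_limit_le _ (measurableTypeR R) _ Omega R (@lebesgue_measure R)
    P _ setT f I _ _ (measurable_itv _) measurableT mf (measurable_funPT I)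
    mg mS (fun n => esym (Sg n)) fs Is).
Qed.

End BrownianIsometry.

(** * Tonelli and Fubini on rectangles *)

Section Rectangles.
Set Implicit Arguments.
Unset Strict Implicit.
Context d1 (T1 : measurableType d1) d2 (T2 : measurableType d2) (R : realType).
Variables (m1 : {sigma_finite_measure set T1 -> \bar R})
          (m2 : {sigma_finite_measure set T2 -> \bar R}).
Variables (A : set T1) (B : set T2).
Hypotheses (mA : measurable A) (mB : measurable B).
Local Open Scope ereal_scope.

(** Cutting off outside a rectangle amounts to cutting off in each variable in turn, which reduces
    integrals over A x B to the theorems on the full product. *)
Let patch_setX (f : T1 * T2 -> \bar R) x y :
  (f \_ (A `*` B)) (x, y) = ((fun x => ((fun y => f (x, y)) \_ B) y) \_ A) x.
Proof.
rewrite !patchE; case: ifPn => [/set_mem[/= xA yB]|/negP nAB].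
  by rewrite mem_set// mem_set.
case: ifPn => // /set_mem xA; case: ifPn => // /set_mem yB.
by exfalso; apply: nAB; rewrite mem_set.
Qed.

Let integral_patch12 (f : T1 * T2 -> \bar R) x :
  \int[m2]_y (f \_ (A `*` B)) (x, y)
  = ((fun x => \int[m2]_(y in B) f (x, y)) \_ A) x.
Proof.
under eq_integral do rewrite patch_setX patchE.
rewrite patchE; case: ifPn => xA; first by rewrite [RHS]integral_mkcond.
exact: integral0.
Qed.

Let integral_patch21 (f : T1 * T2 -> \bar R) y :
  \int[m1]_x (f \_ (A `*` B)) (x, y)
  = ((fun y => \int[m1]_(x in A) f (x, y)) \_ B) y.
Proof.
rewrite patchE; case: ifPn => yB.
  rewrite [RHS]integral_mkcond; apply: eq_integral => x _.
  by rewrite patch_setX !patchE yB.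
rewrite integral0_eq// => x _; rewrite patch_setX !patchE (negbTE yB).
by case: ifP.
Qed.

Let measurable_patch (f : T1 * T2 -> \bar R) :
  measurable_fun (A `*` B) f -> measurable_fun setT (f \_ (A `*` B)).
Proof.
move=> mf; apply/(measurable_restrictT f); last exact: mf.
exact: measurableX.
Qed.

Lemma ge0_integral_setX12 (f : T1 * T2 -> \bar R) :
  measurable_fun (A `*` B) f -> (forall z, 0 <= f z) ->
  \int[m1 \x m2]_(z in A `*` B) f z = \int[m1]_(x in A) \int[m2]_(y in B) f (x, y).
Proof.
move=> mf f0; rewrite integral_mkcond fubini_tonelli1; last 2 first.
- exact: measurable_patch.
- by move=> z; rewrite patchE; case: ifP.
rewrite [RHS]integral_mkcond; apply: eq_integral => x _.
exact: integral_patch12.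
Qed.

Lemma ge0_integral_setX21 (f : T1 * T2 -> \bar R) :
  measurable_fun (A `*` B) f -> (forall z, 0 <= f z) ->
  \int[m1 \x m2]_(z in A `*` B) f z = \int[m2]_(y in B) \int[m1]_(x in A) f (x, y).
Proof.
move=> mf f0; rewrite integral_mkcond fubini_tonelli2; last 2 first.
- exact: measurable_patch.
- by move=> z; rewrite patchE; case: ifP.
rewrite [RHS]integral_mkcond; apply: eq_integral => y _.
exact: integral_patch21.
Qed.

Lemma integral_setXM (f : T1 -> R) (h : T2 -> R) :
  m1.-integrable A (EFin \o f) -> m2.-integrable B (EFin \o h) ->
  (m1 \x m2).-integrable (A `*` B) (fun z => (f z.1 * h z.2)%:E) /\
  \int[m1 \x m2]_(z in A `*` B) (f z.1 * h z.2)%:E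
  = \int[m1]_(x in A) (f x)%:E * \int[m2]_(y in B) (h y)%:E.
Proof.
move=> fi hi.
have mf : measurable_fun A f by apply/measurable_EFinP; exact: measurable_int fi.
have mh : measurable_fun B h by apply/measurable_EFinP; exact: measurable_int hi.
have mfh : measurable_fun (A `*` B) (fun z => (f z.1 * h z.2)%:E).
  apply/measurable_EFinP/measurable_funM.
    apply: (measurable_comp (F := A)) => //; last exact: measurable_funTS.
    by move=> _ [z [zA _] <-].
  apply: (measurable_comp (F := B)) => //; last exact: measurable_funTS.
  by move=> _ [z [_ zB] <-].
have intfh : (m1 \x m2).-integrable (A `*` B) (fun z => (f z.1 * h z.2)%:E).
  apply/integrableP; split=> //.
  rewrite ge0_integral_setX12//; last exact: measurableT_comp.
  under eq_integral => x _.
    under eq_integral do rewrite /= normrM EFinM.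
    rewrite ge0_integralZl//=; last first.
      by apply/measurable_EFinP; exact: measurableT_comp.
    over.
  case/integrableP : fi => _ fi; case/integrableP : hi => _ hi.
  rewrite ge0_integralZr//=; last 2 first.
  - by apply/measurable_EFinP; exact: measurableT_comp.
  - exact: integral_ge0.
  apply: lte_mul_pinfty => //; first exact: integral_ge0.
  by rewrite ge0_fin_numE//; exact: integral_ge0.
split=> //; rewrite integral_mkcond -integral12_prod_meas1; last first.
  by apply/integrable_restrict; rewrite ?setTI//; exact: measurableX.
have hfin := integrable_fin_num mB hi.
rewrite [X in _ = X * _]integral_mkcond -(fineK hfin) -integralZr//.
  apply: eq_integral => x _; rewrite /fubini_F integral_patch12 !patchE.
  case: ifPn => xA; last by rewrite mul0e.
  by rewrite fineK// -integralZl.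
by apply/integrable_restrict; rewrite ?setTI.
Qed.

End Rectangles.

(** * Distance to a linear combination of an orthonormal family *)

Section OrthonormalExpansion.
Set Implicit Arguments.
Unset Strict Implicit.
Context d (T : measurableType d) (R : realType).
Variables (mu : {measure set T -> \bar R}) (D : set T).
Hypothesis mD : measurable D.

Lemma integrableM_sqint (f g : T -> R) :
  measurable_fun D f -> measurable_fun D g ->
  (sqint mu D f < +oo)%E -> (sqint mu D g < +oo)%E ->
  mu.-integrable D (fun t => (f t * g t)%:E).
Proof.
move=> mf mg foo goo; apply: (@le_integrable _ _ _ _ _ mD _
    (fun t => ((f t) ^+ 2)%:E + ((g t) ^+ 2)%:E)%E).
- by apply/measurable_EFinP; exact: measurable_funM.
- move=> t _ /=; rewrite lee_fin normrM [leRHS]ger0_norm ?addr_ge0 ?sqr_ge0//.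
  have := sqr_ge0 (`|f t| - `|g t|); have := sqr_ge0 (`|f t| + `|g t|).
  rewrite -(@real_normK _ (f t)) ?num_real// -(@real_normK _ (g t)) ?num_real//.
  nra.
apply: integrableD => //; apply/integrableP; split.
- exact: measurable_sqE.
- by under eq_integral do rewrite /= ger0_norm ?sqr_ge0//.
- exact: measurable_sqE.
- by under eq_integral do rewrite /= ger0_norm ?sqr_ge0//.
Qed.

Lemma sqint_orthonormal_approx (I : finType) (k : T -> R) (e : I -> T -> R)
    (M : I -> R) :
  measurable_fun D k -> (sqint mu D k < +oo)%E ->
  (forall a, measurable_fun D (e a)) ->
  (forall a b, mu.-integrable D (fun t => (e a t * e b t)%:E)) ->
  (forall a b, \int[mu]_(t in D) (e a t * e b t)%:E = ((a == b)%:R)%:E)%E ->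
  let K a := \int[mu]_(t in D) (e a t * k t) in
  (sqint mu D (fun t => (k t - \sum_a M a * e a t)%R)
   = sqint mu D k - (\sum_a K a ^+ 2)%:E + (\sum_a (K a - M a) ^+ 2)%:E)%E.
Proof.
move=> mk koo me ie oe K.
have ik : mu.-integrable D (fun t => ((k t) ^+ 2)%:E) by exact: integrableM_sqint.
have eoo a : (sqint mu D (e a) < +oo)%E.
  by under eq_integral do rewrite expr2; rewrite oe ltry.
have iek a : mu.-integrable D (fun t => (e a t * k t)%:E).
  exact: integrableM_sqint.
have KE a : (\int[mu]_(t in D) (e a t * k t)%:E)%E = (K a)%:E.
  by rewrite /K /Rintegral fineK//; exact: integrable_fin_num.
(* The share of index a in the expanded square. By orthonormality its integral is M_a^2 - 2 M_a K_a,
   that is (K_a - M_a)^2 - K_a^2. *)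
pose h a t := ((- 2 * M a)%:E * (e a t * k t)%:E
  + \sum_b (M a * M b)%:E * (e a t * e b t)%:E)%E.
have ih2 a : mu.-integrable D
    (fun t => \sum_b (M a * M b)%:E * (e a t * e b t)%:E)%E.
  by apply: integrable_sum => // b _; exact: integrableZl.
have ih1 a : mu.-integrable D (fun t => (- 2 * M a)%:E * (e a t * k t)%:E)%E.
  exact: integrableZl.
have ih a : mu.-integrable D (h a) by exact: integrableD.
have hE a : (\int[mu]_(t in D) h a t = (- 2 * M a * K a + M a ^+ 2)%:E)%E.
  rewrite integralD// integralZl// KE integral_sum//; last first.
    by move=> b; exact: integrableZl.
  rewrite (bigD1 a)//= integralZl// oe eqxx.
  rewrite big1 ?adde0; last first.
    by move=> b ba; rewrite integralZl// oe eq_sym (negbTE ba) mule0.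
  by rewrite mule1 -EFinM -EFinD expr2.
transitivity (\int[mu]_(t in D) (((k t) ^+ 2)%:E + \sum_a h a t))%E.
  apply: eq_integral => t _; rewrite /h.
  under [in RHS]eq_bigr => a _.
    under eq_bigr do rewrite -EFinM.
    rewrite sumEFin -EFinM -EFinD; over.
  rewrite sumEFin -EFinD; congr EFin.
  set S := \sum_a M a * e a t.
  have h1 : \sum_a - 2 * M a * (e a t * k t) = - 2 * k t * S.
    by rewrite mulr_sumr; apply: eq_bigr => a _; ring.
  have h2 : \sum_a \sum_b M a * M b * (e a t * e b t) = S * S.
    rewrite mulr_suml; apply: eq_bigr => a _; rewrite mulr_sumr.
    by apply: eq_bigr => b _; ring.
  by rewrite big_split/= h1 h2; ring.
rewrite integralD//; last by apply: integrable_sum.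
rewrite integral_sum//; under eq_bigr do rewrite hE.
rewrite sumEFin -addeA; congr (_ + _)%E; rewrite -EFinN -EFinD; congr EFin.
rewrite -sumrN -big_split/=; by apply: eq_bigr => a _; ring.
Qed.

End OrthonormalExpansion.

(** * Linearity of the Ito integral and change of interval *)

Section ItoClosure.
Set Implicit Arguments.
Unset Strict Implicit.
Context {R : realType} {d : measure_display} {Omega : measurableType d}
  (P : probability Omega R).
Local Notation mu := (@lebesgue_measure R).

(** The crude factor 2 is harmless: this serves for finiteness and for limits equal to 0. *)
Lemma sqint_lincomb_le d' (T : measurableType d') (m : {measure set T -> \bar R})
    (D : set T) (c : R) (f g h : T -> R) :
  measurable D -> measurable_fun D f -> measurable_fun D g ->
  (forall t, h t = f t + c * g t) ->
  (sqint m D h <= 2%:E * sqint m D f + (2 * c ^+ 2)%:E * sqint m D g)%E.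
Proof.
move=> mD mf mg hE.
have c0 : 0 <= 2 * c ^+ 2 by rewrite mulr_ge0 ?sqr_ge0.
have mf2 := measurable_sqE mf; have mg2 := measurable_sqE mg.
have mh : measurable_fun D h.
  rewrite (funext hE : h = _).
  by apply: measurable_funD => //; exact: measurable_funM.
rewrite -!ge0_integralZl//; try by move=> t _; rewrite lee_fin sqr_ge0.
rewrite -ge0_integralD//.
- apply: ge0_le_integral => //.
  + by move=> t _; rewrite lee_fin sqr_ge0.
  + exact: measurable_sqE.
  + by apply: emeasurable_funD; exact: measurable_funeM.
  + move=> t _; rewrite -!EFinM -EFinD lee_fin hE.
    have := sqr_ge0 (f t - c * g t); nra.
- by move=> t _; rewrite mule_ge0// lee_fin sqr_ge0.
- exact: measurable_funeM.
- by move=> t _; rewrite mule_ge0// lee_fin sqr_ge0.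
- exact: measurable_funeM.
Qed.

Lemma cvge0_lincomb_le (a b : R) (u v w : nat -> \bar R) :
  (forall n, 0 <= w n)%E -> (forall n, w n <= a%:E * u n + b%:E * v n)%E ->
  u @ \oo --> 0%E -> v @ \oo --> 0%E -> w @ \oo --> 0%E.
Proof.
move=> w0 wuv u0 v0.
apply: (@squeeze_cvge _ _ _ _ (cst 0%E) _ (fun n => a%:E * u n + b%:E * v n)%E).
- by apply: nearW => n; rewrite w0 wuv.
- exact: cvg_cst.
- have ca : (a%:E * u n)%E @[n --> \oo] --> (a%:E * 0)%E by apply: cvgeZl.
  have cb : (b%:E * v n)%E @[n --> \oo] --> (b%:E * 0)%E by apply: cvgeZl.
  rewrite !mule0 in ca cb; have := cvgeD _ ca cb.
  by rewrite adde0; apply.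
Qed.

(** B_H(t) is an integral over [0, t] but the V_j are integrals over [0, T]; this brings them to a
    common interval. The same step functions serve, since their intervals end by t. *)
Lemma ito_integral_widen (B : R -> {RV P >-> R}) (a t b : R) (f : R -> R)
    (I : {RV P >-> R}) : t <= b ->
  measurable_fun `[a, b] f -> (forall x, t < x -> f x = 0) ->
  ito_integral B a t f I -> ito_integral B a b f I.
Proof.
move=> tb mf f0 [_ foo [s [sw fs Is]]].
have widen (g : R -> R) : (forall x, t < x -> g x = 0) ->
    sqint mu `[a, b] g = sqint mu `[a, t] g.
  move=> g0; have -> : `[a, t]%classic = `[a, b]%classic `&` `[a, t]%classic :> set R.
    apply/seteqP; split=> x /=; rewrite !in_itv/=; last by case.
    by move=> /andP[ax xt]; rewrite ax xt (le_trans xt tb).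
  rewrite integral_mkcondr; apply: eq_integral => x /set_mem/=.
  rewrite in_itv/= => /andP[ax xb]; rewrite patchE; case: ifPn => // /negP nx.
  rewrite g0 ?expr0n// ltNge; apply/negP => xt; apply: nx.
  by rewrite mem_set//= in_itv/= ax xt.
have s0 n x : t < x -> step_fun (s n) x = 0.
  move=> tx; rewrite /step_fun big_seq big1// => p /(allP (sw n)).
  move=> /andP[_ pt]; rewrite indicE memNset ?mulr0//= in_itv/=.
  by move=> /andP[_ xp]; rewrite ltNge (le_trans xp pt) in tx.
split=> //; first by rewrite widen.
exists s; split=> //.
  move=> n; apply/allP => p /(allP (sw n)) /andP[-> pt]/=.
  exact: le_trans pt tb.
have E n : sqint mu `[a, b] (fun x => f x - step_fun (s n) x)
    = sqint mu `[a, t] (fun x => f x - step_fun (s n) x).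
  by apply: widen => x tx; rewrite f0// s0// subrr.
by under eq_fun do rewrite E.
Qed.

Lemma ito_integral_lincomb (B : R -> {RV P >-> R}) (a b c : R) (f g h : R -> R)
    (I J K : {RV P >-> R}) :
  (forall t, h t = f t + c * g t) -> (forall w, K w = I w + c * J w) ->
  ito_integral B a b f I -> ito_integral B a b g J -> ito_integral B a b h K.
Proof.
move=> hE KE [mf foo [s [sw fs Is]]] [mg goo [r [rw gr Jr]]].
(* Items of a step function may overlap, so a linear combination is a concatenation after
   rescaling. *)
pose q n := s n ++ [seq (c * p.1, p.2) | p <- r n].
have qf n x : step_fun (q n) x = step_fun (s n) x + c * step_fun (r n) x.
  rewrite /step_fun big_cat/= big_map/= mulr_sumr; congr (_ + _).
  by apply: eq_bigr => p _; rewrite mulrA.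
have qi n w : step_integral B (q n) w
    = step_integral B (s n) w + c * step_integral B (r n) w.
  rewrite /step_integral big_cat/= big_map/= mulr_sumr; congr (_ + _).
  by apply: eq_bigr => p _; rewrite mulrA.
split.
- rewrite (funext hE : h = _).
  by apply: measurable_funD => //; exact: measurable_funM.
- apply: (le_lt_trans (sqint_lincomb_le mu _ mf mg hE)) => //.
  apply: lte_add_pinfty; apply: lte_mul_pinfty => //.
  by rewrite lee_fin mulr_ge0 ?sqr_ge0.
exists q; split.
- move=> n; rewrite /step_within all_cat; apply/andP; split; first exact: sw.
  by rewrite all_map; exact: rw.
- apply: (cvge0_lincomb_le (a := 2) (b := 2 * c ^+ 2)) fs gr => n.
    exact: sqint_ge0.
  apply: sqint_lincomb_le => //.
  + by apply: measurable_funB => //; exact: measurable_step_fun.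
  + by apply: measurable_funB => //; exact: measurable_step_fun.
  + by move=> x; rewrite hE qf; ring.
- apply: (cvge0_lincomb_le (a := 2) (b := 2 * c ^+ 2)) Is Jr => n.
    exact: sqint_ge0.
  apply: sqint_lincomb_le => //.
  + by apply: measurable_funB => //; exact: measurable_step_integral.
  + by apply: measurable_funB => //; exact: measurable_step_integral.
  + by move=> w; rewrite KE qi; ring.
Qed.

Lemma ito_integralB_sum (B : R -> {RV P >-> R}) (a b : R) (J : Type)
    (r : seq J) (c : J -> R) (f : R -> R) (g : J -> R -> R)
    (I : {RV P >-> R}) (V : J -> {RV P >-> R}) :
  ito_integral B a b f I -> (forall j, ito_integral B a b (g j) (V j)) ->
  exists2 K : {RV P >-> R}, (forall w, K w = I w - \sum_(j <- r) c j * V j w) &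
    ito_integral B a b (fun t => f t - \sum_(j <- r) c j * g j t) K.
Proof.
move=> fI gV; elim: r => [|j r [K KE fK]].
  exists I => [w|]; first by rewrite big_nil subr0.
  by rewrite (_ : (fun t => _) = f)//; apply/funext => t; rewrite big_nil subr0.
exists (K + cst (- c j) * V j)%R => [w|].
  by rewrite mfunD/= KE big_cons; ring.
apply: (ito_integral_lincomb (c := - c j) _ _ fK (gV j)) => t.
  by rewrite big_cons; ring.
by [].
Qed.

End ItoClosure.

(** * The mean square error for an arbitrary matrix *)

Section MeanSquareError.
Set Implicit Arguments.
Unset Strict Implicit.
Context {R : realType} {d : measure_display} {Omega : measurableType d}
  (P : probability Omega R).
Local Notation mu := (@lebesgue_measure R).

Lemma integral_powR (p T : R) : 0 < p -> 0 < T ->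
  (\int[mu]_(t in `[0%R, T]) (t `^ p)%:E = (T `^ (p + 1) / (p + 1))%:E)%E.
Proof.
move=> p0 T0; have q0 : 0 < p + 1 by rewrite addr_gt0.
(* Powers are differentiated on ]0, +oo[ only; the endpoint 0 enters through a right limit. *)
have cpow (q x : R) : 0 < x -> {for x, continuous (fun t : R => t `^ q)}.
  move=> x0; apply/differentiable_continuous/derivable1_diffP.
  by apply: derivable_powR; rewrite in_itv/= x0.
have cpow0 (q : R) : 0 < q -> t `^ q @[t --> 0^'+] --> 0 `^ q.
  by move=> q_gt0; rewrite powR0 ?gt_eqF//; exact: powR_cvg0.
rewrite (@continuous_FTC2 _ _ (fun t => t `^ (p + 1) / (p + 1)) _ _ T0).
- by rewrite powR0 ?gt_eqF// mul0r sube0.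
- apply/continuous_within_itvP => //; split; [|exact: cpow0|].
    by move=> x; rewrite in_itv/= => /andP[x0 _]; exact: cpow.
  exact/cvg_at_left_filter/cpow.
- split.
  + move=> x; rewrite in_itv/= => /andP[x0 _].
    by apply: derivableM => //; apply: derivable_powR; rewrite in_itv/= x0.
  + by apply: cvgM; [exact: cpow0|exact: cvg_cst].
  + by apply/cvg_at_left_filter; apply: cvgM; [exact: cpow|exact: cvg_cst].
- move=> x; rewrite in_itv/= => /andP[x0 _].
  have xI : x \in `]0, +oo[ by rewrite in_itv/= x0.
  have dp : derivable (fun t : R => t `^ (p + 1)) x 1 by exact: derivable_powR.
  rewrite derive1E deriveM//= derive_cst scaler0 add0r -derive1E powR_derive1//.
  by rewrite addrK /GRing.scale/= mulKf// gt_eqF.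
Qed.

Lemma fbm_kernel_eq0 (H t x : R) : t < x -> fbm_kernel H t x = 0.
Proof. by move=> tx; rewrite /fbm_kernel ifF//; apply/negP; lra. Qed.

Variables (T H : R) (L : nat).
Hypotheses (T_gt0 : 0 < T) (H_gt0 : 0 < H).
Variables (B BH : R -> {RV P >-> R}) (V : 'I_L -> {RV P >-> R}).
Hypotheses (B_bm : brownian_motion T B)
  (BH_fbm : fractional_brownian_motion H T BH)
  (BH_int : forall t, 0 <= t <= T ->
     ito_integral B 0 t (fbm_kernel H t) (BH t))
  (BH_meas : measurable_fun (`[0, T] `*` [set: Omega])
     (fun z : R * Omega => BH z.1 z.2))
  (V_int : forall j : 'I_L, ito_integral B 0 T (legendre T j) (V j)).

Let I := `[0%R, T]%classic : set R.
Let k (z : R * R) := fbm_kernel H z.1 z.2.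
Let e (a : 'I_L * 'I_L) (z : R * R) := legendre T a.1 z.1 * legendre T a.2 z.2.

Let mk : measurable_fun setT k. Proof. exact: measurable_fbm_kernel. Qed.

Let mleg i (D : set R) : measurable_fun D (legendre T i).
Proof.
apply: measurable_funTS; apply: continuous_measurable_fun.
exact: continuous_legendre.
Qed.

Let int_legM i j : mu.-integrable I (EFin \o (fun t => legendre T i t * legendre T j t)).
Proof.
apply: continuous_compact_integrable; first exact: segment_compact.
apply: continuous_subspaceT => x.
by apply: cvgM; exact: continuous_legendre.
Qed.

Let me a (D : set (R * R)) : measurable_fun D (e a).
Proof.
apply/measurable_funTS/measurable_funM.
  by apply: measurableT_comp => //; exact: mleg.
by apply: measurableT_comp => //; exact: mleg.
Qed.

Lemma fbm_sqint (t : R) : 0 <= t <= T -> sqint P setT (BH t) = (t `^ (2 * H))%:E.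
Proof.
case: BH_fbm => _ BH0 BHcov t0T; have := BHcov t t t0T t0T.
(* The diagonal term 0^(2H) vanishes because 2H is nonzero; [powR] takes the value 1 at exponent
   0. *)
rewrite covariance.unlock BH0// /fbm_cov subrr normr0 powR0 ?mulf_neq0 ?gt_eqF//.
rewrite subr0 (_ : 2^-1 * _ = t `^ (2 * H)); last by field.
rewrite unlock => <-; apply: eq_integral => w _; congr EFin.
by rewrite !fctE/= subr0 expr2.
Qed.

Let ito_kernel (t : R) : 0 <= t <= T ->
  ito_integral B 0 T (fbm_kernel H t) (BH t).
Proof.
move=> /[dup] t0T /andP[_ tT].
apply: (ito_integral_widen tT _ _ (BH_int t0T)).
  apply: measurable_funTS.
  exact: (measurableT_comp mk (measurable_pair1 t)).
by move=> x; exact: fbm_kernel_eq0.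
Qed.

Lemma fbm_kernel_normsqE :
  fbm_kernel_normsq H T = (T `^ (2 * H + 1) / (2 * H + 1))%:E.
Proof.
rewrite -integral_powR ?mulr_gt0// /fbm_kernel_normsq ge0_integral_setX12//=.
- apply: eq_integral => t /set_mem/=; rewrite in_itv/= => t0T.
  by rewrite -(ito_isometry B_bm (ito_kernel t0T)) fbm_sqint.
- by apply: measurable_sqE; exact: measurable_funTS.
- by move=> z; rewrite lee_fin sqr_ge0.
Qed.

Let int_ee a b : (mu \x mu)%E.-integrable (I `*` I) (fun z => (e a z * e b z)%:E) /\
  (\int[mu \x mu]_(z in I `*` I) (e a z * e b z)%:E = ((a == b)%:R)%:E)%E.
Proof.
have eE z : e a z * e b z = (legendre T a.1 z.1 * legendre T b.1 z.1)
    * (legendre T a.2 z.2 * legendre T b.2 z.2).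
  by rewrite /e; ring.
under eq_integral do rewrite eE.
have [h1 h2] := @integral_setXM _ _ _ _ _ mu mu I I (measurable_itv _)
  (measurable_itv _) _ _ (int_legM a.1 b.1) (int_legM a.2 b.2).
split; first by rewrite (funext (fun z => congr1 EFin (eE z))).
rewrite h2 !integral_legendreM// -EFinM -natrM mulnb.
by rewrite -pair_eqE/= /pair_eq/=.
Qed.

Lemma sqint_kernel_approx (M : 'M[R]_L) :
  mean_square_error P T BH (spectral_approx T M V)
  = sqint (mu \x mu)%E (I `*` I) (fun z => k z - \sum_a M a.1 a.2 * e a z).
Proof.
have mI : measurable I by exact: measurable_itv.
(* For fixed t these are the coefficients of V_j in the approximation and of P_j(x) in the
   approximate kernel, so one Ito integral carries the whole difference. *)
pose c t j := \sum_(i < L) M i j * legendre T i t.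
have sE t w : spectral_approx T M V t w = \sum_(j < L) c t j * V j w.
  rewrite /spectral_approx exchange_big/=; apply: eq_bigr => j _.
  by rewrite mulr_suml; apply: eq_bigr => i _; rewrite mulrAC.
have gE t x : \sum_a M a.1 a.2 * e a (t, x) = \sum_(j < L) c t j * legendre T j x.
  rewrite -(pair_bigA _ (fun i j => M i j * e (i, j) (t, x)))/= exchange_big/=.
  apply: eq_bigr => j _; rewrite mulr_suml; apply: eq_bigr => i _.
  by rewrite /e/= mulrA.
pose F (z : R * Omega) := ((BH z.1 z.2 - spectral_approx T M V z.1 z.2) ^+ 2)%:E.
have mF : measurable_fun (I `*` setT) F.
  apply: measurable_sqE; apply: measurable_funB => //.
  apply: measurable_funTS; apply: measurable_sum => i; apply: measurable_sum => j.
  apply: measurable_funM; last by apply: measurableT_comp => //; exact: mleg.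
  apply: measurable_funM => //.
  exact: (measurableT_comp (measurable_funPT (V j)) measurable_snd).
have F0 z : (0 <= F z)%E by rewrite lee_fin sqr_ge0.
(* The error integrates over t first, the isometry over Omega at fixed t. The exchange relies on the
   joint measurability of [F]. *)
rewrite /mean_square_error -(ge0_integral_setX21 mu P mI measurableT mF F0)
  (ge0_integral_setX12 mu P mI measurableT mF F0).
rewrite ge0_integral_setX12//; last 2 first.
- apply: measurable_sqE; apply: measurable_funTS; apply: measurable_funB => //.
  by apply: measurable_sum => a; apply: measurable_funM => //; exact: me.
- by move=> z; rewrite lee_fin sqr_ge0.
apply: eq_integral => t /set_mem; rewrite /I/= in_itv/= => t0T.
have [K KE fK] := ito_integralB_sum (index_enum 'I_L) (c t) (ito_kernel t0T) V_int.
transitivity (sqint P setT K).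
  by apply: eq_integral => w _; rewrite /F/= sE KE.
rewrite (ito_isometry B_bm fK); apply: eq_integral => x _.
by rewrite gE.
Qed.

Lemma mean_square_errorE (M : 'M[R]_L) :
  mean_square_error P T BH (spectral_approx T M V)
  = (fbm_kernel_normsq H T - ((frobenius_norm (kernel_mx H T L)) ^+ 2)%:E
     + ((frobenius_norm (kernel_mx H T L - M)) ^+ 2)%:E)%E.
Proof.
have frobE (N : 'M[R]_L) : frobenius_norm N ^+ 2 = \sum_a N a.1 a.2 ^+ 2.
  rewrite /frobenius_norm sqr_sqrtr ?pair_bigA//.
  by apply: sumr_ge0 => a _; exact: sqr_ge0.
(* Square integrability of the kernel is read off from the closed form of its norm, which was
   obtained from the variances of B_H. *)
have koo : (fbm_kernel_normsq H T < +oo)%E by rewrite fbm_kernel_normsqE ltry.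
have mI : measurable I by exact: measurable_itv.
have := @sqint_orthonormal_approx _ (measurableTypeR R * measurableTypeR R)%type
  R (mu \x mu)%E (I `*` I) (measurableX mI mI) _ k e (fun a => M a.1 a.2)
  (measurable_funTS mk) koo (fun a => @me a (I `*` I)) (fun a b => (int_ee a b).1)
  (fun a b => (int_ee a b).2).
rewrite sqint_kernel_approx !frobE => /= ->; congr (_ - _%:E + _%:E)%E.
  by apply: eq_bigr => a _; rewrite mxE.
by apply: eq_bigr => a _; rewrite !mxE.
Qed.

End MeanSquareError.

Theorem theorem2 (R : realType) (d : measure_display)
    (Omega : measurableType d) (P : probability Omega R)
    (T H : R) (L : nat)
    (T_gt0 : 0 < T) (H_gt0 : 0 < H) (H_lt1 : H < 1) (L_gt0 : (0 < L)%N)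
    (B BH : R -> {RV P >-> R}) (V : 'I_L -> {RV P >-> R})
    (B_bm : brownian_motion T B)
    (BH_fbm : fractional_brownian_motion H T BH)
    (BH_int : forall t, 0 <= t <= T ->
       ito_integral B 0 t (fbm_kernel H t) (BH t))
    (BH_meas : measurable_fun (`[0, T] `*` [set: Omega])
       (fun z : R * Omega => BH z.1 z.2))
    (V_int : forall j : 'I_L, ito_integral B 0 T (legendre T j) (V j)) :
  let K := kernel_mx H T L in
  let K' := approx_kernel_mx H T L in
  [/\ fbm_kernel_normsq H T = (T `^ (2 * H + 1) / (2 * H + 1))%:E,
      mean_square_error P T BH (spectral_approx T K V)
      = (fbm_kernel_normsq H T - ((frobenius_norm K) ^+ 2)%:E)%E
    & mean_square_error P T BH (spectral_approx T K' V)
      = (fbm_kernel_normsq H T - ((frobenius_norm K) ^+ 2)%:E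
         + ((frobenius_norm (K - K')) ^+ 2)%:E)%E].
Proof.
move=> K K'; split.
- exact: (fbm_kernel_normsqE T_gt0 H_gt0 B_bm BH_fbm BH_int).
- rewrite (mean_square_errorE T_gt0 H_gt0 B_bm BH_fbm BH_int BH_meas V_int) subrr.
  rewrite [X in (_ + (X ^+ 2)%:E)%E](_ : _ = 0) ?expr0n ?adde0//.
  rewrite /frobenius_norm big1 ?sqrtr0// => i _; rewrite big1// => j _.
  by rewrite mxE expr0n.
- exact: (mean_square_errorE T_gt0 H_gt0 B_bm BH_fbm BH_int BH_meas V_int).
Qed.
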